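(* Let $\mathcal{P}=\sum_{j=0}^n\mathcal{P}_j\mathsf{Y}^j\in\mathcal{C}[\mathsf{Y}]$ be such that $\mathcal{P}_n=1$. The following assertions are equivalent: (1) There exist $\mathcal{Y}_1,\dots,\mathcal{Y}_n\in\mathcal{C}$ such that $\mathcal{Y}_1(\epsilon),\dots,\mathcal{Y}_n(\epsilon)$ are the roots of $\mathcal{P}(\epsilon)=\sum_{j=0}^n\mathcal{P}_j(\epsilon)\mathsf{Y}^j$ counted with multiplicities, and $\mathcal{Y}_1,\dots,\mathcal{Y}_n$ have first order asymptotics, $\mathcal{Y}_j(\epsilon)\sim y_j\epsilon^{Y_j}$ with $Y_1\le\cdots\le Y_n$; (2) There exist $p=\sum_{j=0}^np_j\mathsf{Y}^j\in\mathbb{C}[\mathsf{Y}]$ and $P=\bigoplus_{j=0}^nP_j\mathsf{Y}^j\in\mathbb{R}_{\min}[\mathsf{Y}]$ satisfying $\mathcal{P}_j(\epsilon)\simeq p_j\epsilon^{P_j}$, $j=0,\dots,n$, with $p_n=1$, $P_n=0$, with $p_0\ne0$ or $P_0=+\infty$, and with $p_{n-i}\ne0$ for all $i\in\{1,\dots,n-1\}$ such that $c_i<c_{i+1}$, where $(c_1\le\cdots\le c_n)=\mathsf{R}(P)$ is the sequence of roots of $P$. When these assertions hold, we have $\mathsf{e}(\mathcal{P})\ge P$, $\overline{\mathsf{e}(\mathcal{P})}=\overline P$, and $\mathsf{R}(\mathsf{e}(\mathcal{P}))=\mathsf{R}(P)=(c_1\le\cdots\le c_n)=(Y_1\le\cdots\le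 Y_n)$. Moreover, if $c\in\mathbb{R}$ is a root of $P$ with multiplicity $m$ and $c_{i+1}=\cdots=c_{i+m}=c$, then $y_{i+1},\dots,y_{i+m}$ are precisely the non-zero roots, counted with multiplicities, of the polynomial $$p^{(c)}=\sum_{0\le j\le n,\ \widehat P(c)=P_j+jc}p_j\mathsf{Y}^j\in\mathbb{C}[\mathsf{Y}].$$
   Context: $\mathcal{C}$ is the ring of germs at $0^+$ of continuous functions $f:(0,\epsilon_0)\to\mathbb{C}$ (some $\epsilon_0>0$) such that $|f(\epsilon)|\le\epsilon^{-k}$ on $(0,\epsilon_0)$ for some constant $k>0$ (functions coinciding near $0$ are identified). For $f\in\mathcal{C}$, $a\in\mathbb{C}$, $A\in\mathbb{R}\cup\{+\infty\}$: $f(\epsilon)\simeq a\epsilon^A$ means $\lim_{\epsilon\to0^+}\epsilon^{-A}f(\epsilon)=a$ if $A\in\mathbb{R}$, and $f=0$ (near $0$) if $A=+\infty$. One writes $f\sim a\epsilon^A$, and says $f$ has first order asymptotics, if $f\simeq a\epsilon^A$ and either $A\in\mathbb{R}$, $a\ne0$, or $A=+\infty$. The exponent of $f\in\mathcal{C}$ is $\mathsf{e}(f)=\liminf_{\epsilon\to0^+}\frac{\log|f(\epsilon)|}{\log\epsilon}\in\mathbb{R}\cup\{+\infty\}$, and $\mathsf{e}(\mathcal{P}):=\bigoplus_{j=0}^n\mathsf{e}(\mathcal{P}_j)\mathsf{Y}^j$. $\mathbb{R}_{\min}=\mathbb{R}\cup\{+\infty\}$ is the min-plus semifield (addition $\min$,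 multiplication $+$, zero $+\infty$, unit $0$). For a formal polynomial $P=\bigoplus_{j=0}^nP_j\mathsf{Y}^j$ of degree $n$ over $\mathbb{R}_{\min}$ ($P_n\neq+\infty$), $\widehat P(y)=\min_j(P_j+jy)$ is the associated polynomial function (the term $j=0$ being $P_0$); it factors uniquely as $\widehat P(y)=P_n+\sum_{i=1}^n\min(y,c_i)$ with $c_1\le\cdots\le c_n$ in $\mathbb{R}_{\min}$. The $c_i$ are the roots of $P$, the multiplicity of a root being its number of occurrences, and $\mathsf{R}(P)=(c_1,\dots,c_n)$. $\overline P$ denotes the formal polynomial whose coefficients are $\overline P_k=(\operatorname{vex}P)(k)$, $k\in\mathbb{N}$, where $\operatorname{vex}P$ is the convex hull (largest convex minorant) of the function $\mathbb{R}\to\mathbb{R}\cup\{+\infty\}$ equal to $P_k$ at $k\in\mathbb{N}$ and $+\infty$ elsewhere. Inequalities between formal polynomials are coefficientwise. *)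

(* Defs.v *)
From HB Require Import structures.
From mathcomp Require Import all_boot all_order all_algebra.
From mathcomp Require Import complex.
From mathcomp Require Import all_classical all_reals all_analysis.

Set Implicit Arguments.
Unset Strict Implicit.
Unset Printing Implicit Defensive.

Import Order.TTheory GRing.Theory Num.Theory.
Import numFieldNormedType.Exports.
Import ComplexField.Normc.

Local Open Scope classical_set_scope.
Local Open Scope ring_scope.
Local Open Scope complex_scope.

(* A germ at 0^+ is handled through a representative [f : R -> R[i]], whose
   values outside some interval ]0, e0[ are irrelevant. Equality of germs is
   equality near [0^'+], and all the notions below only depend on germs. *)
Definition moderate_germ (R : realType) (f : R -> R[i]) : Prop :=
  exists e0 : R, exists k : R,
    [/\ 0 < e0, 0 < k,
        {within `]0, e0[, continuous (f : R -> R[i]^o)} &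
        {in `]0, e0[, forall e, normc (f e) <= e `^ (- k)}].

(* An element of R_min is an [A : \bar R] with [A != -oo]. The formal
   polynomial of degree at most n over R_min with coefficients P_0, ..., P_n is
   the family [P : 'I_n.+1 -> \bar R]; its other coefficients are +oo. *)

Definition simeq_pow (R : realType) (f : R -> R[i]) (a : R[i]) (A : \bar R) :
    Prop :=
  match A with
  | r%:E => (fun e : R => (e `^ (- r))%:C * f e : R[i]^o) @ 0^'+ --> (a : R[i]^o)
  | +oo%E => \forall e \near 0^'+, f e = 0
  | -oo%E => False
  end.

Definition first_order (R : realType) (f : R -> R[i]) (a : R[i]) (A : \bar R) :
    Prop :=
  simeq_pow f a A /\ ((A \is a fin_num /\ a != 0) \/ A = +oo%E).

(* Where f vanishes, [lne] gives -oo and the quotient is +oo (for e < 1). *)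
Definition exponent (R : realType) (f : R -> R[i]) : \bar R :=
  limf_einf (fun e : R => lne (normc (f e))%:E / (ln e)%:E)%E (0^'+).

Definition exponent_poly (R : realType) (n : nat)
    (calP : 'I_n.+1 -> R -> R[i]) : 'I_n.+1 -> \bar R :=
  fun j => exponent (calP j).

Definition poly_at (R : realType) (n : nat) (calP : 'I_n.+1 -> R -> R[i])
    (e : R) : {poly R[i]} :=
  \sum_(j < n.+1) calP j e *: 'X^j.

Definition trop_eval (R : realType) (n : nat) (P : 'I_n.+1 -> \bar R)
    (y : \bar R) : \bar R :=
  (\big[mine/+oo]_(j < n.+1) (P j + y *+ j))%E.

(* [trop_roots P c] : P has degree n and R(P) = c. *)
Definition trop_roots (R : realType) (n : nat) (P : 'I_n.+1 -> \bar R)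
    (c : n.-tuple (\bar R)) : Prop :=
  [/\ P ord_max != +oo%E,
      forall i, tnth c i != -oo%E,
      sorted <=%O c &
      forall y : \bar R, y != -oo%E ->
        trop_eval P y = (P ord_max + \sum_(i < n) mine y (tnth c i))%E].

Definition coef_fun (R : realType) (n : nat) (P : 'I_n.+1 -> \bar R) (x : R) :
    \bar R :=
  (\big[mine/+oo]_(k < n.+1 | x == k%:R :> R) P k)%E.

Definition convex_efun (R : realType) (g : R -> \bar R) : Prop :=
  forall x y t : R, 0 <= t <= 1 ->
    (g (t * x + (1 - t) * y)%R <= t%:E * g x + (1 - t)%:E * g y)%E.

(* The largest convex minorant is the pointwise supremum of all of them. *)
Definition vex (R : realType) (f : R -> \bar R) (x : R) : \bar R :=
  ereal_sup [set g x | g in [set g : R -> \bar R |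
    [/\ forall z, g z != -oo%E, convex_efun g & forall z, (g z <= f z)%E]]].

Definition trop_hull (R : realType) (n : nat) (P : 'I_n.+1 -> \bar R) (k : nat) :
    \bar R :=
  vex (coef_fun P) k%:R.

(* The guard [q != 0] is needed since [mup z 0 = 0]. *)
Definition roots_with_mult (F : fieldType) (q : {poly F}) (s : seq F) : Prop :=
  q != 0 /\ forall z, count_mem z s = mup z q.

Definition nonzero_roots_with_mult (F : fieldType) (q : {poly F}) (s : seq F) :
    Prop :=
  q != 0 /\ forall z, count_mem z s = if z == 0 then 0%N else mup z q.

Definition root_asymptotics (R : realType) (n : nat)
    (calP : 'I_n.+1 -> R -> R[i]) (calY : 'I_n -> R -> R[i])
    (y : n.-tuple R[i]) (Y : n.-tuple (\bar R)) : Prop :=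
  [/\ forall j, moderate_germ (calY j),
      \forall e \near 0^'+,
        roots_with_mult (poly_at calP e) [seq calY j e | j : 'I_n],
      forall j, first_order (calY j) (tnth y j) (tnth Y j) &
      sorted <=%O Y].

(* The sequence c_1 <= ... <= c_n is the 0-indexed tuple [c], so that c_i and
   c_{i+1} are its entries of index i.-1 and i. *)
Definition coef_asymptotics (R : realType) (n : nat)
    (calP : 'I_n.+1 -> R -> R[i])
    (p : {poly R[i]}) (P : 'I_n.+1 -> \bar R) (c : n.-tuple (\bar R)) : Prop :=
  [/\ [/\ (size p <= n.+1)%N, forall j, P j != -oo%E & trop_roots P c],
      forall j : 'I_n.+1, simeq_pow (calP j) p`_j (P j),
      p`_n = 1 /\ P ord_max = 0%E,
      p`_0 != 0 \/ P ord0 = +oo%E &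
      forall i : nat, (1 <= i <= n.-1)%N ->
        (nth +oo c i.-1 < nth +oo c i)%E -> p`_(n - i) != 0].

Definition edge_poly (R : realType) (n : nat)
    (p : {poly R[i]}) (P : 'I_n.+1 -> \bar R) (c : R) : {poly R[i]} :=
  \sum_(j < n.+1 | trop_eval P c%:E == (P j + c%:E *+ j)%E) p`_j *: 'X^j.

(* Main.v *)
Require Import Defs.
From HB Require Import structures.
From mathcomp Require Import all_boot all_order all_algebra.
From mathcomp Require Import complex.
From mathcomp Require Import fingroup perm.
From mathcomp Require Import all_classical all_reals all_analysis.
From mathcomp Require Import ring lra zify.

(** The roots of a monic polynomial whose coefficients are continuous on an
    interval admit continuous selections: order the roots on the grid of step
    1/m so that consecutive orderings are as close as possible, and let m tend
    to infinity along an ultrafilter. Close to a point the chain of roots cannot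
    jump from one cluster of roots to another, so these selections are
    equicontinuous and their limit is continuous.

    Given (2), consider a branch of roots along an ultrafilter tending to 0. If
    no scale [e^c_i] matches its size, it lies strictly between two consecutive
    scales and the term of the corresponding vertex of the Newton polygon
    dominates all the others, which is impossible; otherwise the rescaled branch
    converges to a nonzero root of the edge polynomial. There are finitely many
    possible limits, and near 0 they are far apart, so by connectedness a
    continuous branch follows a single one of them.

    Conversely, given (1), the coefficients are the elementary symmetric
    functions of the roots. Their exponents are at least the partial sums of the
    sorted exponents of the roots, with equality at the vertices. Both
    descriptions determine the convex hull of the exponents, hence the tropical
    roots, and evaluating [e^-M P(e^c x)] with [M] the value at [c] of the
    tropical polynomial identifies the edge polynomial. *)

Set Implicit Arguments.
Unset Strict Implicit.
Unset Printing Implicit Defensive.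

Import Order.TTheory GRing.Theory Num.Theory.
Import numFieldNormedType.Exports.

Local Open Scope classical_set_scope.
Local Open Scope ring_scope.

Import ComplexField.Normc.
Local Open Scope complex_scope.

(** * Complex limits and ultrafilters *)

Section Normc.
Context {R : realType}.
Implicit Types z w : R[i].

Lemma normr_normc z : `|z| = (normc z)%:C.
Proof. by []. Qed.

Lemma normc_ge0 z : 0 <= normc z.
Proof. by case: z => a b; exact: sqrtr_ge0. Qed.

Lemma normc_eq0 z : (normc z == 0) = (z == 0).
Proof.
by apply/eqP/eqP => [|->]; [exact: eq0_normc|exact: normc0].
Qed.

Lemma normc_gt0 z : (0 < normc z) = (z != 0).
Proof. by rewrite lt_def normc_eq0 normc_ge0 andbT. Qed.

Lemma normc_real (a : R) : normc a%:C = `|a|.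
Proof. by rewrite /normc /= expr0n addr0 sqrtr_sqr. Qed.

Lemma normcX z n : normc (z ^+ n) = normc z ^+ n.
Proof. by elim: n => [|n IH]; rewrite ?expr0 ?normc1// !exprS normcM IH. Qed.

Lemma normc_distC z w : normc (z - w) = normc (w - z).
Proof. by rewrite -normcN opprB. Qed.

Lemma normc_triangle (z w u : R[i]) : normc (z - u) <= normc (z - w) + normc (w - u).
Proof. by apply: le_trans (le_normcD _ _); rewrite addrA subrK. Qed.

Lemma normc_sum (I : Type) (r : seq I) (P : pred I) (G : I -> R[i]) :
  normc (\sum_(i <- r | P i) G i) <= \sum_(i <- r | P i) normc (G i).
Proof.
elim/big_rec2: _ => [|i y x _ xy]; first by rewrite normc0.
by apply: le_trans (le_normcD _ _) _; rewrite lerD2l.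
Qed.

Lemma Re_le_normc z : `|complex.Re z| <= normc z.
Proof. by rewrite -lecR; exact: normc_ge_Re. Qed.

Lemma Im_le_normc z : `|complex.Im z| <= normc z.
Proof.
by case: z => a b /=; rewrite -sqrtr_sqr ler_wsqrtr // lerDr sqr_ge0.
Qed.

Lemma normc_le_ReIm z : normc z <= `|complex.Re z| + `|complex.Im z|.
Proof.
case: z => a b /=; rewrite -[leRHS]ger0_norm ?addr_ge0// -sqrtr_sqr ler_wsqrtr //.
by rewrite sqrrD !real_normK ?num_real// lerD2r lerDl mulrn_wge0// mulr_ge0.
Qed.

End Normc.

(** Convergence in [R[i]] as a normed space over itself, hence [R[i]^o]; locked so that this
    topology stays out of later unification problems. *)
HB.lock Definition cvgc (R : realType) (T : Type) (F : set_system T) (f : T -> R[i])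
    (l : R[i]) : Prop :=
  (f : T -> R[i]^o) @ F --> (l : R[i]^o).

Lemma cvgcE (R : realType) (T : Type) (F : set_system T) (f : T -> R[i]) (l : R[i]) :
  cvgc F f l = ((f : T -> R[i]^o) @ F --> (l : R[i]^o)).
Proof. by rewrite cvgc.unlock. Qed.

Section ComplexLimits.
Context {R : realType} {T : Type} {F : set_system T}.
Implicit Types f g : T -> R[i].

Lemma cvgcP {FF : Filter F} f (l : R[i]) :
  cvgc F f l <->
  forall e : R, 0 < e -> \forall x \near F, normc (f x - l) < e.
Proof.
rewrite cvgcE; split.
  move=> /cvgrPdistC_lt fl e e0.
  have /fl : 0 < e%:C :> R[i] by rewrite ltcR.
  by apply: filterS => x; rewrite normr_normc ltcR.
move=> H; apply/cvgrPdistC_lt => e e0.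
have eE : e = (complex.Re e)%:C.
  by case: e e0 => a b; rewrite ltcE /= => /andP[/eqP -> _].
have e'0 : 0 < complex.Re e by move: e0; rewrite eE ltcR.
have := H _ e'0; apply: filterS => x.
by rewrite eE normr_normc ltcR.
Qed.

Lemma cvgc_cst {FF : Filter F} (a : R[i]) : cvgc F (fun=> a) a.
Proof.
by apply/cvgcP => e e0; apply: (filterS _ filterT) => x _; rewrite subrr normc0.
Qed.

Lemma cvgcD {FF : Filter F} f g (a b : R[i]) :
  cvgc F f a -> cvgc F g b -> cvgc F (fun x => f x + g x) (a + b).
Proof. by rewrite !cvgcE => fa gb; exact: (@cvgD R[i] R[i]^o T F FF f g a b fa gb). Qed.

Lemma cvgcM {FF : Filter F} f g (a b : R[i]) :
  cvgc F f a -> cvgc F g b -> cvgc F (fun x => f x * g x) (a * b).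
Proof. by rewrite !cvgcE => fa gb; exact: (@cvgM R[i] T F FF f g a b fa gb). Qed.

Lemma cvgcB {FF : Filter F} f g (a b : R[i]) :
  cvgc F f a -> cvgc F g b -> cvgc F (fun x => f x - g x) (a - b).
Proof. by rewrite !cvgcE => fa gb; exact: (@cvgB R[i] R[i]^o T F FF f g a b fa gb). Qed.

Lemma cvgc_near_eq {FF : Filter F} f g (a : R[i]) :
  (\forall x \near F, f x = g x) -> cvgc F f a -> cvgc F g a.
Proof.
move=> fg /cvgcP fa; apply/cvgcP => e /fa fe.
by apply: filterS2 fg fe => x ->.
Qed.

Lemma cvgc_le_bound {FF : ProperFilter F} f (l w : R[i]) (d : R) :
  cvgc F f l ->
  (\forall x \near F, normc (f x - w) <= d) -> normc (l - w) <= d.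
Proof.
move=> /cvgcP fl fd; apply/ler_addgt0Pr => e e0.
have [x [xl xd]] : exists x, normc (f x - l) < e /\ normc (f x - w) <= d.
  exact: (@filter_ex _ F _ _ (filterI (fl _ e0) fd)).
apply: le_trans (normc_triangle l (f x) w) _.
by rewrite addrC lerD// normc_distC ltW.
Qed.

Lemma cvgc_real {FF : Filter F} (f : T -> R) (l : R) :
  f @ F --> l -> cvgc F (fun x => (f x)%:C) l%:C.
Proof.
move=> /cvgrPdistC_lt fl; apply/cvgcP => e /fl.
by apply: filterS => x; rewrite -rmorphB normc_real.
Qed.

Lemma cvgc_sum {FF : Filter F} (I : Type) (r : seq I) (P : pred I)
    (f : I -> T -> R[i]) (l : I -> R[i]) :
  (forall i, P i -> cvgc F (f i) (l i)) ->
  cvgc F (fun x => \sum_(i <- r | P i) f i x) (\sum_(i <- r | P i) l i).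
Proof.
move=> H; elim: r => [|i r IH].
  by rewrite big_nil; under eq_fun do rewrite big_nil; exact: cvgc_cst.
rewrite big_cons; under eq_fun do rewrite big_cons.
by case: (P i) (H i) => [/(_ isT) Hi|_]; [exact: cvgcD Hi IH|exact: IH].
Qed.

Lemma cvgc_prod {FF : Filter F} (I : Type) (r : seq I) (P : pred I)
    (f : I -> T -> R[i]) (l : I -> R[i]) :
  (forall i, P i -> cvgc F (f i) (l i)) ->
  cvgc F (fun x => \prod_(i <- r | P i) f i x) (\prod_(i <- r | P i) l i).
Proof.
move=> H; elim: r => [|i r IH].
  by rewrite big_nil; under eq_fun do rewrite big_nil; exact: cvgc_cst.
rewrite big_cons; under eq_fun do rewrite big_cons.
by case: (P i) (H i) => [/(_ isT) Hi|_]; [exact: cvgcM Hi IH|exact: IH].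
Qed.

Lemma cvgcX {FF : Filter F} f (l : R[i]) n :
  cvgc F f l -> cvgc F (fun x => f x ^+ n) (l ^+ n).
Proof.
move=> fl; elim: n => [|n IH]; first by rewrite expr0; exact: cvgc_cst.
by rewrite exprS; under eq_fun do rewrite exprS; exact: cvgcM.
Qed.

Lemma cvgc_unique {FF : ProperFilter F} f (a b : R[i]) :
  cvgc F f a -> cvgc F f b -> a = b.
Proof.
move=> fa fb; apply/eqP; rewrite -subr_eq0 -normc_eq0 eq_le normc_ge0 andbT.
apply/ler_addgt0Pr => e e0; rewrite add0r.
apply: (cvgc_le_bound fa); move/cvgcP: fb => /(_ _ e0).
by apply: filterS => x /ltW.
Qed.

Lemma cvgc_bounded {FF : Filter F} f (l : R[i]) : cvgc F f l ->
  \forall x \near F, normc (f x) <= normc l + 1.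
Proof.
move=> /cvgcP /(_ 1 ltr01); apply: filterS => x /ltW xl.
rewrite -[f x]subr0; apply: le_trans (normc_triangle _ l _) _.
by rewrite subr0 addrC lerD2l.
Qed.

Lemma cvgc_sub_filter (G : set_system T) f (l : R[i]) : F `<=` G ->
  cvgc F f l -> cvgc G f l.
Proof. by rewrite !cvgcE => FG fl; exact: cvg_trans (cvg_app _ FG) fl. Qed.

Lemma cvgc_comp {S : Type} {G : set_system S} f (h : S -> T) (l : R[i]) :
  h @ G --> F -> cvgc F f l -> cvgc G (f \o h) l.
Proof. by rewrite !cvgcE => hG fl; exact: cvg_comp hG fl. Qed.

End ComplexLimits.

Section Ultra.
Context {T : Type}.

(** If [Q] were not in [F], the traces of [F] on the complement of [Q] would generate a proper
    filter; an ultrafilter above it would contain both [Q] and its complement. *)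
Lemma near_ultra (F : set_system T) {FF : Filter F} (Q : set T) :
  (forall U, UltraFilter U -> F `<=` U -> U Q) -> F Q.
Proof.
move=> H; apply: contrapT => nFQ.
pose G := [set A | exists2 B, F B & B `&` ~` Q `<=` A].
have PG : ProperFilter G.
  apply: Build_ProperFilter.
    move=> [B FB BQ]; apply: nFQ; apply: filterS FB => x Bx.
    by apply: contrapT => nQx; apply: (BQ x).
  split.
  - by exists setT => //; exact: filterT.
  - move=> A B [A' FA' sA] [B' FB' sB]; exists (A' `&` B'); first exact: filterI.
    by move=> x [[? ?] ?]; split; [apply: sA|apply: sB].
  - by move=> A B AB [A' FA' sA]; exists A' => //; apply: subset_trans AB.
have [U [UU GU]] := ultraFilterLemma PG.
have UQ : U Q.
  apply: H => A FA; apply: GU; exists A => //; exact: subIsetl.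
have UnQ : U (~` Q).
  by apply: GU; exists setT; [exact: filterT|rewrite setTI].
have : U (Q `&` ~` Q) by exact: filterI.
by rewrite setICr => /filter_not_empty.
Qed.

(** The real and imaginary parts send [U] to ultrafilters on the compact segment [[-M, M]], which
    converge. *)
Lemma ultra_bounded_cvg (R : realType) (U : set_system T) {UU : UltraFilter U}
    (f : T -> R[i]) (M : R) :
  (\forall x \near U, normc (f x) <= M) ->
  exists l : R[i], cvgc U f l.
Proof.
move=> fM.
have H (g : T -> R) : (\forall x \near U, `|g x| <= M) -> exists l : R, g @ U --> l.
  move=> gM.
  have : UltraFilter (g @ U).
    split; first exact: fmap_proper_filter.
    move=> G GF gUG; rewrite eqEsubset; split => // A GA.
    have [//|UA] := in_ultra_setVsetC (g @^-1` A) UU.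
    have : G (~` A) by apply: gUG.
    by move/(filterI GA); rewrite setICr => /filter_not_empty.
  move=> UG; have := @segment_compact R (- M) M; rewrite compact_ultra.
  move=> /(_ _ UG)[|l [_ gl]]; last by exists l.
  by apply: filterS gM => x /=; rewrite in_itv /= ler_norml.
have [a ha] := H (fun x => complex.Re (f x))
  (filterS (fun x h => le_trans (Re_le_normc _) h) fM).
have [b hb] := H (fun x => complex.Im (f x))
  (filterS (fun x h => le_trans (Im_le_normc _) h) fM).
exists (a +i* b); apply/cvgcP => e e0.
have e2 : 0 < e / 2 by rewrite divr_gt0.
move/cvgrPdistC_lt : ha => /(_ _ e2) ha; move/cvgrPdistC_lt : hb => /(_ _ e2) hb.
apply: filterS2 ha hb => x xa xb.
apply: le_lt_trans (normc_le_ReIm _) _.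
by rewrite (splitr e) ltrD//; move: xa xb => /=; case: (f x).
Qed.

End Ultra.

Lemma cvgc_ultra (R : realType) (T : Type) (F : set_system T) {FF : Filter F}
   (f : T -> R[i]) (l : R[i]) :
  (forall U, UltraFilter U -> F `<=` U ->
     cvgc U f l) ->
  cvgc F f l.
Proof.
move=> H; apply/cvgcP => e e0; apply: near_ultra => U UU FU.
by have /cvgcP := H U UU FU; apply.
Qed.

(** * Continuous selection of roots *)

Section RootMatching.
Context {R : realType} {n : nat}.
Implicit Types u v l : 'I_n -> R[i].

Lemma poly_eq_horner (K : numDomainType) (p q : {poly K}) :
  (forall x, p.[x] = q.[x]) -> p = q.
Proof.
move=> pq; apply/eqP; rewrite -subr_eq0; apply/eqP.
apply: (@roots_geq_poly_eq0 _ _ [seq k%:R | k <- iota 0 (size (p - q))]).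
- by apply/allP => _ /mapP[k _ ->]; rewrite rootE hornerD hornerN pq subrr.
- by rewrite map_inj_uniq ?iota_uniq//; exact: mulrIn.
- by rewrite size_map size_iota.
Qed.

Lemma horner_prod_XsubC (K : comNzRingType) (I : Type) (r : seq I) (g : I -> K) x :
  (\prod_(j <- r) ('X - (g j)%:P)).[x] = \prod_(j <- r) (x - g j).
Proof. by rewrite horner_prod; apply: eq_bigr => j _; rewrite hornerXsubC. Qed.

Lemma prod_sub_eq_perm u v :
  (forall x, \prod_j (x - u j) = \prod_j (x - v j)) ->
  exists s : 'S_n, forall j, u j = v (s j).
Proof.
move=> uv; pose tu := [tuple u i | i < n]; pose tv := [tuple v i | i < n].
have /prod_XsubC_eq /tuple_permP[s sE] :
    \prod_(x <- tu) ('X - x%:P) = \prod_(x <- tv) ('X - x%:P).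
  apply: poly_eq_horner => x; rewrite !horner_prod_XsubC !big_tuple.
  under eq_bigr do rewrite tnth_mktuple.
  by under [RHS]eq_bigr do rewrite tnth_mktuple; exact: uv.
exists s => j; have /(congr1 (fun t => tnth t j)) := val_inj sE.
by rewrite !tnth_mktuple.
Qed.

(** Along a finer ultrafilter the bounded functions [g^~ j] converge, and the limits of the products
    show that their limits are a permutation of [l]. This permutation depends on the ultrafilter, so
    [s] may vary with [t]. *)
Lemma matching (T : Type) (F : set_system T) {FF : ProperFilter F}
    (g : T -> 'I_n -> R[i]) l (M d : R) :
  (\forall t \near F, forall j, normc (g t j) <= M) ->
  (forall x, cvgc F (fun t => \prod_j (x - g t j)) (\prod_j (x - l j))) ->
  0 < d ->
  \forall t \near F, exists s : 'S_n, forall j, normc (g t j - l (s j)) < d.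
Proof.
move=> gM gl d0; apply: near_ultra => U UU FU.
have /choice[w gw] j : exists w : R[i], cvgc U (g^~ j) w.
  apply: (@ultra_bounded_cvg _ _ _ _ _ M).
  by apply: FU; apply: filterS gM => t; apply.
have /prod_sub_eq_perm[s ws] x : \prod_j (x - w j) = \prod_j (x - l j).
  apply: (@cvgc_unique _ _ U _ (fun t => \prod_j (x - g t j))).
    by apply: cvgc_prod => j _; apply: cvgcB => //; exact: cvgc_cst.
  exact: cvgc_sub_filter FU _.
have : \forall t \near U, forall j, normc (g t j - w j) < d.
  by apply: filter_forall => j; move/cvgcP: (gw j); apply.
by apply: filterS => t gt; exists s => j; rewrite -ws.
Qed.

Lemma separation l :
  exists2 d : R, 0 < d & forall i j, normc (l i - l j) < d -> l i = l j.
Proof.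
have H i j : \forall d \near (0 : R)^'+, normc (l i - l j) < d -> l i = l j.
  have [lij|lij] := eqVneq (l i) (l j); first by apply: nearW.
  have : 0 < normc (l i - l j) by rewrite normc_gt0 subr_eq0.
  move=> /nbhs_right_lt; apply: filterS => d dl ld.
  by have := lt_trans ld dl; rewrite ltxx.
have H' := filter_forall _ (fun i => filter_forall _ (H i)).
have [d [d0 dl]] := filter_ex (filterI (nbhs_right_gt (0 : R)) (H' _ _)).
by exists d.
Qed.

Definition match_cost u v (s : 'S_n) : R := \sum_j normc (u j - v (s j)).

Definition best_match u v : 'S_n := [arg min_(s < 1%g) match_cost u v s]%O.

(** The minimal total cost is at most that of [t], hence at most [n * d], and it bounds each
    distance. *)
Lemma best_matchP u v (d : R) (t : 'S_n) :
  (forall j, normc (u j - v (t j)) <= d) ->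
  forall j, normc (u j - v (best_match u v j)) <= n%:R * d.
Proof.
move=> ut j; rewrite /best_match; case: arg_minP => //= s _ smin.
have : match_cost u v s <= n%:R * d.
  apply: le_trans (smin t isT) _.
  apply: (@le_trans _ _ (\sum_(j < n) d)); first by apply: ler_sum => i _.
  by rewrite sumr_const card_ord mulr_natl.
apply: le_trans; rewrite /match_cost (bigD1 j)//= lerDl.
by apply: sumr_ge0 => i _; exact: normc_ge0.
Qed.

End RootMatching.

(** * Chains of roots on a grid and their limit *)

Section ContinuousRoots.
Context {R : realType} {n : nat} (f : R -> 'I_n -> R[i]) (e0 : R).

Hypothesis f_cont : forall t, 0 < t < e0 -> forall x,
  cvgc (nbhs t) (fun s => \prod_j (x - f s j)) (\prod_j (x - f t j)).
Hypothesis f_bound : forall t, 0 < t < e0 ->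
  exists M : R, \forall s \near t, forall j, normc (f s j) <= M.

(** The grid has step [1 / m.+1], which avoids dividing by zero; each list of roots is reordered to
    be as close as possible to the previous reordered one. *)
Fixpoint root_chain (m k : nat) : 'I_n -> R[i] :=
  if k is k'.+1 then
    f (k%:R / m.+1%:R) \o best_match (root_chain m k') (f (k%:R / m.+1%:R))
  else f 0.

Lemma root_chain_perm m k :
  exists s : 'S_n, forall j, root_chain m k j = f (k%:R / m.+1%:R) (s j).
Proof.
case: k => [|k] /=; first by exists 1%g => j; rewrite mul0r perm1.
by eexists => j.
Qed.

(** Two lists within [d] of [l] up to order can be matched within [2 * d], so the best match moves
    each root by at most [2 * n * d]. A jump from one value of [l] to another would need these two
    values to be closer than [(2 + 2 * n) * d]. *)
Lemma root_chain_step (l : 'I_n -> R[i]) (d : R) m k :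
  (forall i j, normc (l i - l j) < (2 + 2 * n%:R) * d -> l i = l j) ->
  (forall i, (k <= i <= k.+1)%N ->
    exists s : 'S_n, forall j, normc (f (i%:R / m.+1%:R) j - l (s j)) < d) ->
  forall i j, normc (root_chain m k j - l i) < d ->
    normc (root_chain m k.+1 j - l i) < d.
Proof.
move=> sep near_l i j ki.
have /near_l[s fs] : (k <= k <= k.+1)%N by rewrite leqnn leqnSn.
have /near_l[s' fs'] : (k <= k.+1 <= k.+1)%N by rewrite leqnn leqnSn.
have [r chr] := root_chain_perm m k.
set u := root_chain m k; set v := f (k.+1%:R / m.+1%:R).
have uv j' : normc (u j' - v ((r * s * s'^-1)%g j')) <= 2 * d.
  rewrite /u chr; apply: le_trans (normc_triangle _ (l (s (r j'))) _) _.
  have := fs' ((r * s * s'^-1)%g j'); rewrite !permM permKV normc_distC.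
  by have := fs (r j'); rewrite -/v; lra.
have := best_matchP uv j; rewrite -/u; set b := best_match u v => ub.
have vb : normc (v (b j) - l (s' (b j))) < d by exact: fs'.
suff -> : l i = l (s' (b j)) by [].
apply: sep; apply: le_lt_trans (normc_triangle _ (u j) _) _.
rewrite normc_distC.
have := normc_triangle (u j) (v (b j)) (l (s' (b j))).
by move: ki ub vb; rewrite -/u; lra.
Qed.

(** Each step stays near the same [l i], so the two ends are within [d] of a common point. The bound
    [2 * d] does not depend on the number of steps: this gives equicontinuity in [m]. *)
Lemma root_chain_near (l : 'I_n -> R[i]) (d : R) m k r :
  (forall i j, normc (l i - l j) < (2 + 2 * n%:R) * d -> l i = l j) ->
  (forall i, (k <= i <= k + r)%N ->
    exists s : 'S_n, forall j, normc (f (i%:R / m.+1%:R) j - l (s j)) < d) ->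
  forall j, normc (root_chain m k j - root_chain m (k + r) j) < 2 * d.
Proof.
move=> sep near_l j.
have [i ki] : exists i, normc (root_chain m k j - l i) < d.
  have /near_l[s fs] : (k <= k <= k + r)%N by rewrite leqnn leq_addr.
  by have [t ->] := root_chain_perm m k; exists (s (t j)).
suff : normc (root_chain m (k + r) j - l i) < d.
  move=> kri; apply: le_lt_trans (normc_triangle _ (l i) _) _.
  by rewrite [in X in _ + X]normc_distC; move: ki kri; lra.
elim: r near_l => [|r IH] near_l; first by rewrite addn0.
rewrite addnS; apply: root_chain_step => //.
  by move=> i' ik; apply: near_l; lia.
by apply: IH => i' ik; apply: near_l; lia.
Qed.

Definition grid_index (m : nat) (t : R) : nat := Num.truncn (t * m.+1%:R).
Definition grid_point (m : nat) (t : R) : R := (grid_index m t)%:R / m.+1%:R.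

Lemma grid_point_near m t : 0 < t -> t - m.+1%:R^-1 <= grid_point m t <= t.
Proof.
move=> t0; have m0 : 0 < m.+1%:R :> R by rewrite ltr0n.
rewrite /grid_point ler_pdivrMr// ler_pdivlMr// mulrBl mulVf ?lt0r_neq0//.
have := @truncn_itv R (t * m.+1%:R) (mulr_ge0 (ltW t0) (ltW m0)).
by rewrite /grid_index -natr1 => /andP[? ?]; apply/andP; split => //; lra.
Qed.

Lemma cvg_grid_point t : 0 < t -> grid_point^~ t @ \oo --> t.
Proof.
move=> t0; apply/cvgrPdist_lt => e e0'.
apply: filterS (near_infty_natSinv_lt (PosNum e0')) => m /= me.
have /andP[? ?] := grid_point_near m t0.
by rewrite ger0_norm ?subr_ge0//; apply: le_lt_trans me; rewrite lerBlDr addrC -lerBlDr.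
Qed.

Theorem continuous_roots : exists Y : 'I_n -> R -> R[i],
  (forall j t, 0 < t < e0 -> cvgc (nbhs t) (Y j) (Y j t)) /\
  (forall t, 0 < t < e0 -> exists s : 'S_n, forall j, Y j t = f t (s j)).
Proof.
have [U [UU NU]] := ultraFilterLemma (_ : ProperFilter \oo).
have gridU t : 0 < t -> (grid_point^~ t) @ U --> t.
  by move=> t0; exact: cvg_trans (cvg_app _ NU) (cvg_grid_point t0).
have ex_Y (p : 'I_n * R) : exists y : R[i], 0 < p.2 < e0 ->
    cvgc U (fun m => root_chain m (grid_index m p.2) p.1) y.
  case: p => j t /=.
  have [t0|t0] := boolP (0 < t < e0); last by exists 0.
  have [M fM] := f_bound t0.
  suff [y yP] : exists y : R[i], cvgc U (fun m => root_chain m (grid_index m t) j) y.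
    by exists y.
  apply: (@ultra_bounded_cvg _ _ _ _ _ M).
  have /andP[t_gt0 _] := t0.
  have Um : \forall m \near U, forall j, normc (f (grid_point m t) j) <= M.
    exact: gridU t t_gt0 _ fM.
  apply: filterS Um => m fmM.
  by have [s ->] := root_chain_perm m (grid_index m t); exact: fmM.
have {ex_Y} [Y YP] := choice ex_Y.
exists (fun j t => Y (j, t)); split => [j t t0|t t0]; last first.
  have /andP[t_gt0 _] := t0.
  (* The chain permutes the roots at the grid point, so the products converge both to the product of
     the limits and, by continuity, to the product at [t]. *)
  apply: prod_sub_eq_perm => x.
  apply: (@cvgc_unique _ _ U _
    (fun m => \prod_j (x - root_chain m (grid_index m t) j))).
    apply: cvgc_prod => j _; apply: cvgcB; first exact: cvgc_cst.
    exact: (YP (j, t)).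
  have := cvgc_comp (gridU t t_gt0) (@f_cont t t0 x); apply: cvgc_near_eq.
  apply: nearW => m /=.
  have [s chs] := root_chain_perm m (grid_index m t).
  rewrite (reindex_inj (@perm_inj _ s)) /=.
  by apply: eq_bigr => j _; rewrite chs.
apply/cvgcP => e e_gt0.
have [d0 d0_gt0 sep0] := separation (f t).
have n2 : 0 < 2 + 2 * n%:R :> R by rewrite ltr_pwDl// mulr_ge0.
(* The first bound makes the final oscillation [2 * d] less than [e]; the second one makes the
   distinct values of [f t] far enough apart for the chain to stay near one of them. *)
pose d := Num.min (e / 4) (d0 / (2 + 2 * n%:R)).
have d_gt0 : 0 < d by rewrite lt_min !divr_gt0.
have d_le : (2 + 2 * n%:R) * d <= d0.
  by rewrite mulrC -ler_pdivlMr// ge_min lexx orbT.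
have sep i i' : normc (f t i - f t i') < (2 + 2 * n%:R) * d -> f t i = f t i'.
  by move=> ii; apply: sep0; exact: lt_le_trans d_le.
have [M fM] := f_bound t0.
have /nbhs_ballP[r /= r0 rN] : nbhs t [set s |
    exists s' : 'S_n, forall j, normc (f s j - f t (s' j)) < d].
  exact: matching fM (@f_cont t t0) d_gt0.
have near_m s : 0 < s -> `|s - t| < r -> \forall m \near U, `|grid_point m s - t| < r.
  move=> s0 st; have rst : 0 < r - `|s - t| by rewrite subr_gt0.
  have /cvgrPdist_lt /(_ _ rst) Us := gridU s s0; near=> m.
  have : `|s - grid_point m s| < r - `|s - t| by near: m.
  rewrite distrC => h; apply: le_lt_trans (ler_distD s _ _) _; move: h; lra.
have /andP[t_gt0 _] := t0.
near=> s.
have s_gt0 : 0 < s by near: s; exact: lt_nbhsr.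
have s_lt : s < e0 by near: s; apply: lt_nbhsl; case/andP: t0.
have st : `|s - t| < r by near: s; apply/nbhs_ballP; exists r => //= z /=; rewrite distrC.
apply: (@le_lt_trans _ _ (2 * d)); last first.
  have : d <= e / 4 by rewrite ge_min lexx.
  by lra.
rewrite -[X in normc X]subr0.
apply: (@cvgc_le_bound _ _ U _ (fun m => root_chain m (grid_index m s) j -
   root_chain m (grid_index m t) j)).
  by apply: cvgcB; [apply: (YP (j, s)); rewrite s_gt0|exact: (YP (j, t))].
have tt : `|t - t| < r by rewrite subrr normr0.
apply: filterS2 (near_m s s_gt0 st) (near_m t t_gt0 tt) => m ms mt.
rewrite subr0; apply: ltW.
have conv (a b g : R) : `|a - t| < r -> `|b - t| < r -> a <= g -> g <= b -> `|t - g| < r.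
  rewrite !ltr_norml => /andP[? ?] /andP[? ?] ? ?.
  by apply/andP; split; lra.
(* Every grid point between those of [s1] and [s2] lies in the ball around [t], where the roots are
   within [d] of those of [f t]. *)
have chain s1 s2 : `|grid_point m s1 - t| < r -> `|grid_point m s2 - t| < r ->
    (grid_index m s1 <= grid_index m s2)%N ->
    normc (root_chain m (grid_index m s1) j - root_chain m (grid_index m s2) j) < 2 * d.
  move=> h1 h2 s12; rewrite -(subnKC s12); apply: (@root_chain_near (f t)) => //.
  move=> i; rewrite subnKC// => /andP[i1 i2]; apply: (rN (i%:R / m.+1%:R)).
  have m0 : 0 < m.+1%:R :> R by rewrite ltr0n.
  have : grid_point m s1 <= i%:R / m.+1%:R by rewrite ler_pM2r ?invr_gt0// ler_nat.
  have : i%:R / m.+1%:R <= grid_point m s2 by rewrite ler_pM2r ?invr_gt0// ler_nat.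
  by move=> ? ?; rewrite -ball_normE; exact: (conv _ _ _ h1 h2).
by have [|/ltnW] := leqP (grid_index m s) (grid_index m t) => st';
  [|rewrite normc_distC]; exact: chain.
Unshelve. all: by end_near.
Qed.

End ContinuousRoots.

(** * Tropical polynomials *)

Section Tropical.
Context {R : realType} (n : nat).
Local Open Scope ereal_scope.
Implicit Types (P Q : 'I_n.+1 -> \bar R) (g h : nat -> \bar R) (y : \bar R).

(** Meant for [nth +oo c]: the value [+oo] past the end of the tuple keeps the sequence
    nondecreasing on all of [nat]. *)
Definition nondecr_roots g : Prop :=
  (forall i j, (i <= j)%N -> g i <= g j) /\ (forall i, g i != -oo).

Definition psum g k : \bar R := \sum_(0 <= i < k) g i.

(** Index [k] stands for the abscissa [n - k] of the Newton polygon: it is an end, or the slope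
    changes there between the zero-based roots [g k.-1] and [g k]. *)
Definition vertex g k := [|| k == 0%N, k == n | g k.-1 < g k].

(* [psum g (n - j)] is the coefficient of index [j] of the tropical product of
   the [n] linear factors of roots [g 0 <= g 1 <= ...]. *)
Definition newton_spec P g : Prop :=
  [/\ P ord_max = 0, forall j : 'I_n.+1, psum g (n - j)%N <= P j &
      forall j : 'I_n.+1, vertex g (n - j)%N -> P j = psum g (n - j)%N].

Definition min_sum g y : \bar R := \sum_(0 <= i < n) mine y (g i).

Lemma psumS g k : psum g k.+1 = psum g k + g k.
Proof. by rewrite /psum big_nat_recr. Qed.

Lemma psum_nNy g k : nondecr_roots g -> psum g k != -oo.
Proof.
move=> [_ gN]; elim: k => [|k IH]; first by rewrite /psum big_geq.
by rewrite psumS adde_eq_ninfty negb_or IH gN.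
Qed.

Lemma psum_fin g k : nondecr_roots g -> (forall i, (i < k)%N -> g i != +oo) ->
  psum g k \is a fin_num.
Proof.
move=> [_ gN]; elim: k => [|k IH] gk; first by rewrite /psum big_geq.
rewrite psumS fin_numD IH ?fin_numE ?gN ?gk// => i ik.
by apply: gk; exact: ltn_trans ik _.
Qed.

Lemma psum_eqy g i k : nondecr_roots g -> (i < k)%N -> g i = +oo ->
  psum g k = +oo.
Proof.
move=> ng; elim: k => // k IH; rewrite ltnS leq_eqVlt psumS => /predU1P[<- ->|ik gi].
  by rewrite addey// psum_nNy.
by rewrite IH// addye//; case: ng.
Qed.

Lemma enatmulS y k : y *+ k.+1 = y + y *+ k.
Proof. by case: k => //=; rewrite adde0. Qed.

Lemma sum_const_nat_enatmul y i k : \sum_(i <= l < i + k) y = y *+ k.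
Proof.
elim: k => [|k IH]; first by rewrite addn0 big_geq.
rewrite addnS big_nat_recr ?leq_addr// IH.
by rewrite enatmulS addeC.
Qed.

Lemma min_sum_le g y k : (k <= n)%N -> min_sum g y <= psum g k + y *+ (n - k)%N.
Proof.
move=> kn; rewrite /min_sum (@big_cat_nat _ _ _ k)//= -(@sum_const_nat_enatmul y k).
rewrite subnKC// leeD// /psum; apply: lee_sum => i _; first by rewrite ge_min lexx orbT.
by rewrite ge_min lexx.
Qed.

Lemma min_sumE g y k : (k <= n)%N ->
  (forall i, (i < k)%N -> g i <= y) -> (forall i, (k <= i < n)%N -> y <= g i) ->
  min_sum g y = psum g k + y *+ (n - k)%N.
Proof.
move=> kn gy yg; rewrite /min_sum (@big_cat_nat _ _ _ k)//= -(@sum_const_nat_enatmul y k).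
rewrite subnKC//; congr (_ + _); apply: eq_big_nat => i ik.
  by rewrite min_r// gy.
by rewrite min_l// yg.
Qed.

Lemma find_threshold g (p : pred (\bar R)) : nondecr_roots g ->
  (forall x z, p x -> x <= z -> p z) ->
  exists2 k, (k <= n)%N &
    (forall i, (i < k)%N -> ~~ p (g i)) /\ (forall i, (k <= i < n)%N -> p (g i)).
Proof.
move=> [gm _] pup; pose s := mkseq g n.
exists (find p s); first by rewrite -[X in (_ <= X)%N](size_mkseq g n) find_size.
split=> i.
  move=> ik; have iN : (i < n)%N.
    by rewrite -[n](size_mkseq g n); apply: leq_trans ik (find_size _ _).
  by have := before_find +oo ik; rewrite nth_mkseq// => ->.
move=> /andP[ki iN].
have hs : has p s by rewrite has_find size_mkseq; exact: leq_ltn_trans ki iN.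
have := nth_find +oo hs; rewrite nth_mkseq; last exact: leq_ltn_trans ki iN.
by move=> pg; apply: pup pg _; exact: gm.
Qed.

(** Cutting where the roots reach [y] gives [g k.-1 < y <= g k], a strict change of slope unless [k]
    is [0] or [n]. *)
Lemma min_sum_vertex g y : nondecr_roots g -> exists2 k, (k <= n)%N &
  vertex g k /\ min_sum g y = psum g k + y *+ (n - k)%N.
Proof.
move=> ng.
have [|k kn [k1 k2]] := @find_threshold g (fun x => y <= x) ng.
  by move=> x z /= yx; exact: le_trans.
exists k => //; split; last first.
  by apply: min_sumE => // i /k1; rewrite -ltNge => /ltW.
rewrite /vertex; case: eqVneq => //= k0; case: eqVneq => //= kn'.
have := k1 k.-1; rewrite -ltNge prednK ?lt0n// => /(_ (leqnn _)) /lt_le_trans; apply.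
by apply: k2; rewrite leqnn ltn_neqAle kn' kn.
Qed.

Lemma min_sum_fin g (a : R) : nondecr_roots g -> min_sum g a%:E \is a fin_num.
Proof.
move=> [_ gN]; rewrite /min_sum; elim/big_ind: _ => // [x y|i _].
  by rewrite fin_numD => -> ->.
by move: (gN i); case: (g i) => [b| |]// _; rewrite ?miney// -EFin_min.
Qed.

Lemma trop_eval_le P y j : trop_eval P y <= P j + y *+ j.
Proof. by rewrite /trop_eval; exact: bigmin_le_cond. Qed.

Lemma trop_evalP P y : exists j, trop_eval P y = P j + y *+ j.
Proof.
have [j _ Ej] := eq_bigmin ord0 xpredT (fun j : 'I_n.+1 => P j + y *+ j) isT
  (fun j _ => leey _).
by exists j.
Qed.

(** The value of [min_sum] is attained at a vertex, where the coefficient is exact; the other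
    coefficients lie above [psum] and cannot lower the minimum. *)
Lemma newton_spec_eval P g y : nondecr_roots g -> newton_spec P g ->
  trop_eval P y = min_sum g y.
Proof.
move=> ng [_ Pge Pv]; apply/eqP; rewrite eq_le; apply/andP; split.
  have [k kn [vk ->]] := min_sum_vertex y ng.
  have kE : (n - (n - k)%N)%N = k by rewrite subKn.
  pose j : 'I_n.+1 := Ordinal (leq_subr k n : (n - k < n.+1)%N).
  by apply: le_trans (trop_eval_le P y j) _; rewrite Pv /= kE.
have [j ->] := trop_evalP P y.
apply: le_trans (min_sum_le g y (leq_subr j n)) _.
by rewrite subKn ?leeD// -ltnS.
Qed.

Lemma min_sum_tuple (c : n.-tuple (\bar R)) y :
  \sum_(i < n) mine y (tnth c i) = min_sum (nth +oo c) y.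
Proof.
by rewrite /min_sum big_mkord; apply: eq_bigr => i _; rewrite (tnth_nth +oo).
Qed.

Lemma nondecr_tuple (c : n.-tuple (\bar R)) : sorted <=%O c ->
  (forall i, tnth c i != -oo) -> nondecr_roots (nth +oo c).
Proof.
move=> sc cN; split => [i j ij|i].
  have [jn|jn] := ltnP j n; last by rewrite [leRHS]nth_default ?leey// size_tuple.
  apply: (sorted_leq_nth le_trans lexx +oo sc) => //.
    by rewrite inE size_tuple; exact: leq_ltn_trans ij jn.
  by rewrite inE size_tuple.
have [iN|iN] := ltnP i n; last by rewrite nth_default// size_tuple.
by have := cN (Ordinal iN); rewrite (tnth_nth +oo).
Qed.

Lemma newton_spec_trop_roots P (c : n.-tuple (\bar R)) : sorted <=%O c ->
  (forall i, tnth c i != -oo) -> newton_spec P (nth +oo c) -> trop_roots P c.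
Proof.
move=> sc cN Pc; have ng := nondecr_tuple sc cN.
have P0 : P ord_max = 0 by case: Pc.
split => // [|y yN]; first by rewrite P0.
by rewrite P0 add0e min_sum_tuple; exact: newton_spec_eval.
Qed.

Lemma fin_enatmul (r : R) k : r%:E *+ k = (r *+ k)%:E.
Proof. by rewrite EFin_natmul. Qed.

(** The tropical function bounds the coefficients from below and determines them at the vertices, by
    evaluation at well chosen points: at [g k.-1] for the bounds, inside an interval of linearity
    for an inner vertex. *)
Lemma trop_roots_newton_spec P (c : n.-tuple (\bar R)) :
  (forall j, P j != -oo) -> P ord_max = 0 ->
  trop_roots P c -> newton_spec P (nth +oo c).
Proof.
move=> PN P0 [_ cN sc Pc]; have ng := nondecr_tuple sc cN.
have [gm gN] := ng.
set g := nth +oo c in ng gm gN *.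
have {Pc} Pc y : y != -oo -> trop_eval P y = min_sum g y.
  by move=> yN; rewrite Pc// P0 add0e min_sum_tuple.
have Pge y j : y != -oo -> min_sum g y <= P j + y *+ j.
  by move=> yN; rewrite -Pc//; exact: trop_eval_le.
have psum0 : psum g 0 = 0 by rewrite /psum big_geq.
have gge (j : 'I_n.+1) : psum g (n - j)%N <= P j.
  have [jn|jn] := eqVneq (j : nat) n.
    by rewrite jn subnn psum0 (_ : j = ord_max) ?P0//; exact: val_inj.
  have jltn : (j < n)%N by rewrite ltn_neqAle jn -ltnS ltn_ord.
  set k := (n - j)%N; have k0 : (0 < k)%N by rewrite subn_gt0.
  have kn : (k <= n)%N by rewrite leq_subr.
  have nk : (n - k)%N = j by rewrite subKn// ltnW.
  have [gk|gk] := eqVneq (g k.-1) +oo; last first.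
    have gfin : g k.-1 \is a fin_num by rewrite fin_numE gN gk.
    have := Pge (g k.-1) j (gN _); rewrite (@min_sumE g _ k) ?nk//.
    - rewrite -(fineK gfin) fin_enatmul leeD2rE//.
    - by move=> i ik; apply: gm; lia.
    - by move=> i ik; apply: gm; lia.
  suff -> : P j = +oo by exact: leey.
  have := PN j; case EP: (P j) => [r| |]// _; exfalso.
  have [|k' k'n [k1 k2]] := @find_threshold g (fun x => x == +oo) ng.
    by move=> x z /= /eqP ->; rewrite leye_eq.
  have k'k : (k' < k)%N.
    rewrite ltnNge; apply/negP => kk'.
    by have := k1 k.-1; rewrite gk eqxx prednK// => /(_ kk').
  have bfin : psum g k' \is a fin_num by exact: psum_fin.
  have [a ga] : exists a : R, forall i, (i < k')%N -> g i <= a%:E.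
    case: k' k1 {k'n k2 k'k bfin} => [|l] k1; first by exists 0%R.
    exists (fine (g l)) => i il.
    by rewrite fineK ?fin_numE ?gN ?k1//; exact: gm.
  (* For large [y] the tropical function has slope [n - k' > j], which a term with finite [P j]
     cannot bound. This [y] exceeds all finite roots, is nonnegative, and a single extra [y] already
     exceeds the gap between [r] and [psum g k']. *)
  pose y := Num.max a (Num.max 0 (r - fine (psum g k') + 1))%R.
  have := Pge y%:E j isT; rewrite (@min_sumE g _ k')//; last 2 first.
  - by move=> i /ga ia; apply: le_trans ia _; rewrite lee_fin le_max lexx.
  - by move=> i /k2 /eqP ->; exact: leey.
  rewrite EP !fin_enatmul -(fineK bfin) -!EFinD lee_fin.
  have y0 : (0 <= y)%R by rewrite !le_max lexx orbT.
  have yr : (r - fine (psum g k') + 1 <= y)%R by rewrite !le_max lexx !orbT.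
  have -> : (n - k' = j + (n - k' - j - 1)%N + 1)%N by lia.
  rewrite !mulrnDr mulr1n.
  have := mulrn_wge0 (n - k' - j - 1)%N y0.
  move: (y *+ _)%R (y *+ _)%R => u v; lra.
split => // j vj.
have [jn|jn] := eqVneq (j : nat) n.
  by rewrite jn subnn psum0 (_ : j = ord_max) ?P0//; exact: val_inj.
(* At abscissa 0 the coefficient is read off at [+oo], where all the other terms are infinite. *)
have [j0|j0] := eqVneq (j : nat) 0%N.
  have -> : psum g (n - j)%N = min_sum g +oo.
    by rewrite (@min_sumE g _ n) ?j0 ?subn0 ?subnn ?adde0// => i; [rewrite leey|lia].
  rewrite -Pc//; apply/eqP; rewrite eq_le; apply/andP; split; last first.
    by apply: le_trans (trop_eval_le P +oo j) _; rewrite j0 /= adde0.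
  have [j' ->] := trop_evalP P +oo.
  have [->|j'0] := eqVneq j' j; first by rewrite j0 /= adde0.
  have j'_gt0 : (0 < j')%N.
    by rewrite lt0n; apply: contra j'0 => /eqP j'0; apply/eqP/val_inj; rewrite /= j'0 j0.
  by rewrite -(prednK j'_gt0) enatmul_pinfty addey ?leey.
have jltn : (j < n)%N by rewrite ltn_neqAle jn -ltnS ltn_ord.
move: vj; rewrite /vertex; set k := (n - j)%N.
have k0 : (0 < k)%N by rewrite subn_gt0.
have kn : (k < n)%N by rewrite /k; lia.
have nk : (n - k)%N = j by rewrite subKn// ltnW.
rewrite gtn_eqF// ltn_eqF//= => gk.
have afin : g k.-1 \is a fin_num.
  by rewrite fin_numE gN; apply/eqP => h; move: gk; rewrite h ltNge leey.
set a := fine (g k.-1).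
have aE : g k.-1 = a%:E by rewrite fineK.
have [y2 [ay2 y2g]] : exists y2 : R, (a < y2)%R /\ y2%:E <= g k.
  move: gk; rewrite aE; case: (g k) => [b| |]// ab; last first.
    by exists (a + 1)%R; rewrite ltrDl leey.
  by exists b; move: ab; rewrite lte_fin.
have bfin : psum g k \is a fin_num.
  apply: psum_fin => // i ik; apply: contraTneq gk => gi.
  rewrite aE -leNgt; have := gm i k.-1; rewrite gi aE leye_eq => /(_ _)/eqP.
  by move=> h; have := h ltac:(lia).
have SE (y : R) : (a <= y <= y2)%R ->
    min_sum g y%:E = (fine (psum g k) + y *+ j)%:E.
  move=> /andP[ay yy2]; rewrite (@min_sumE g _ k) ?nk//; last 3 first.
  - exact: ltnW.
  - move=> i ik; apply: (@le_trans _ _ (g k.-1)); first by apply: gm; lia.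
    by rewrite aE lee_fin.
  - move=> i ik; apply: (@le_trans _ _ (g k)); last by apply: gm; lia.
    by apply: le_trans y2g; rewrite lee_fin.
  by rewrite fin_enatmul EFinD fineK.
(* On [[a, y2]] the tropical function is affine of slope [j]. A term [j'] that attains it at an
   interior point and stays above it at both ends has the same slope, so [j' = j]. *)
pose y := ((a + y2) / 2)%R.
have ay : (a < y)%R by rewrite /y; lra.
have yy2 : (y < y2)%R by rewrite /y; lra.
have [j' j'E] := trop_evalP P y%:E.
have : P j' + y%:E *+ j' = (fine (psum g k) + y *+ j)%:E.
  by rewrite -j'E Pc// SE// !ltW.
have := Pge a%:E j' isT; rewrite SE; last by apply/andP; split; lra.
have := Pge y2%:E j' isT; rewrite SE; last by apply/andP; split; lra.
have := PN j'; rewrite !fin_enatmul.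
case EP: (P j') => [r| |]//; rewrite -!EFinD !lee_fin => _ h2 h1 [h0].
have jj' : j = j'.
  apply: val_inj => /=.
  have H (z : R) : (fine (psum g k) + z *+ j <= r + z *+ j')%R ->
      (0 <= (z - y) * (j'%:R - j%:R))%R.
    move=> hz; rewrite mulrBl !mulrBr !mulr_natr.
    by move: hz h0; move: (z *+ j)%R (z *+ j')%R (y *+ j)%R (y *+ j')%R => *; lra.
  have := H _ h1; have := H _ h2.
  rewrite pmulr_rge0 ?subr_gt0// nmulr_rge0 ?subr_lt0// subr_ge0 subr_le0 !ler_nat.
  by move=> ? ?; apply/eqP; rewrite eqn_leq; apply/andP.
rewrite jj' EP -(fineK bfin); congr (_%:E).
by move: h0; rewrite jj'; move: (y *+ _)%R => *; lra.
Qed.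

End Tropical.

(** * Uniqueness of the tropical roots and of the convex hull *)

Section TropicalUniqueness.
Context {R : realType} (n : nat).
Local Open Scope ereal_scope.
Implicit Types (P Q : 'I_n.+1 -> \bar R) (g h : nat -> \bar R) (y : \bar R).

(** Take [y] with [g k < y <= h k]. From index [k] on the minima for [h] all equal [y], whereas the
    one for [g] at [k] is smaller; before [k] they agree. *)
Lemma min_sum_lt g h k : nondecr_roots g -> nondecr_roots h -> (k < n)%N ->
  (forall l, (l < k)%N -> g l = h l) -> g k < h k ->
  exists y : R, min_sum n g y%:E < min_sum n h y%:E.
Proof.
move=> ng nh kn gh ghk; have [gm gN] := ng; have [hm hN] := nh.
have afin : g k \is a fin_num.
  by rewrite fin_numE gN; apply/eqP => H; move: ghk; rewrite H ltNge leey.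
have [a aE] : exists a, g k = a%:E by exists (fine (g k)); rewrite fineK.
have [y [ay yh]] : exists y : R, (a < y)%R /\ y%:E <= h k.
  move: ghk; rewrite aE; case: (h k) => [b| |]// ab; last first.
    by exists (a + 1)%R; rewrite ltrDl leey.
  by exists b; move: ab; rewrite lte_fin.
exists y.
have bfin : psum g k \is a fin_num.
  apply: psum_fin => // i ik; apply/eqP => gi.
  by have := gm i k (ltnW ik); rewrite gi aE leye_eq.
have psE : psum h k = psum g k by apply: eq_big_nat => i ik; rewrite gh.
rewrite (@min_sumE _ _ h _ k) ?psE//; last 3 first.
- exact: ltnW.
- move=> i ik; rewrite -gh//; apply: (@le_trans _ _ (g k)); first exact: gm (ltnW ik).
  by rewrite aE lee_fin ltW.
- by move=> i /andP[ki _]; apply: le_trans yh _; exact: hm.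
apply: (le_lt_trans (min_sum_le g y%:E kn)).
rewrite psumS aE -(fineK bfin) !fin_enatmul -!EFinD lte_fin.
by rewrite -(subnSK kn) mulrS; move: (y *+ _)%R => z; lra.
Qed.

Lemma min_sum_inj g h : nondecr_roots g -> nondecr_roots h ->
  (forall y : R, min_sum n g y%:E = min_sum n h y%:E) ->
  forall k, (k < n)%N -> g k = h k.
Proof.
move=> ng nh gh; elim/ltn_ind => k IH kn.
have IH' l : (l < k)%N -> g l = h l.
  by move=> lk; apply: IH => //; exact: ltn_trans lk kn.
apply/eqP; case: ltgtP => // lt; exfalso.
  have [y] := min_sum_lt ng nh kn IH' lt.
  by rewrite gh ltxx.
have [y] := min_sum_lt nh ng kn (fun l lk => esym (IH' l lk)) lt.
by rewrite gh ltxx.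
Qed.

Lemma newton_spec_unique P (c d : n.-tuple (\bar R)) :
  nondecr_roots (nth +oo c) -> nondecr_roots (nth +oo d) ->
  newton_spec P (nth +oo c) -> newton_spec P (nth +oo d) -> c = d.
Proof.
move=> nc nd Pc Pd; apply: eq_from_tnth => i; rewrite !(tnth_nth +oo).
apply: (min_sum_inj nc nd) => // y.
by rewrite -!(newton_spec_eval _ _ Pc)// -!(newton_spec_eval _ _ Pd).
Qed.

Lemma le_coef_fun P (q : R -> \bar R) :
  (forall z, q z <= coef_fun P z) <-> (forall k : 'I_n.+1, q k%:R%R <= P k).
Proof.
split => [qP k|qP z].
  apply: le_trans (qP _) _; rewrite /coef_fun.
  exact: (@bigmin_le_cond _ _ _ +oo k).
rewrite /coef_fun; elim/big_ind: _ => [|x y xz yz|k /eqP ->].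
- exact: leey.
- by rewrite le_min xz yz.
- exact: qP.
Qed.

(** [psum] is affine between consecutive vertices, so a convex function below it at the two ends of
    an edge is below it along the edge. *)
Lemma convex_le_psum g (q : R -> \bar R) : nondecr_roots g ->
  (forall z, q z != -oo) -> convex_efun q ->
  (forall k, (k <= n)%N -> vertex n g k -> q (n - k)%N%:R%R <= psum g k) ->
  forall k, (k <= n)%N -> q (n - k)%N%:R%R <= psum g k.
Proof.
move=> ng qN qconv qv k kn; have [gm gN] := ng.
have [vk|] := boolP (vertex n g k); first exact: qv.
rewrite /vertex !negb_or -leNgt -lt0n => /and3P[k0 kn' gk].
have {kn' kn} kn : (k < n)%N by rewrite ltn_neqAle kn' kn.
have {}gk : g k.-1 = g k by apply/eqP; rewrite eq_le gk gm// leq_pred.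
have [gkoo|gkoo] := eqVneq (g k) +oo.
  have -> : psum g k = +oo.
    rewrite -(prednK k0) psumS gk gkoo addey//; exact: psum_nNy.
  exact: leey.
have [a aE] : exists a, g k = a%:E by exists (fine (g k)); rewrite fineK// fin_numE gN.
(* [k1] and [k2] bound the run of roots equal to [g k]: they are the ends of the edge through [k],
   and [k1 < k < k2]. *)
have [|k1 k1n [k1l k1r]] := @find_threshold _ n g (fun x => g k <= x) ng.
  by move=> x z /= ?; exact: le_trans.
have [|k2 k2n [k2l k2r]] := @find_threshold _ n g (fun x => g k < x) ng.
  by move=> x z /= ?; exact: lt_le_trans.
have k1k : (k1 < k)%N.
  rewrite ltnNge; apply/negP => kk1.
  by have := k1l k.-1; rewrite gk lexx prednK// => /(_ kk1).
have kk2 : (k < k2)%N.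
  rewrite ltnNge; apply/negP => k2k.
  by have := k2r k; rewrite ltxx k2k kn => /(_ isT).
have v1 : vertex n g k1.
  rewrite /vertex; have [//|k10] := eqVneq k1 0%N.
  rewrite [_ < _](_ : _ = true) ?orbT//.
  have := k1l k1.-1; rewrite prednK ?lt0n// leqnn -ltNge => /(_ isT)/lt_le_trans; apply.
  by apply: k1r; lia.
have v2 : vertex n g k2.
  rewrite /vertex; have [//|k2n'] := eqVneq k2 n; first by rewrite orbT.
  rewrite [_ < _](_ : _ = true) ?orbT//.
  have := k2l k2.-1; rewrite prednK; last by lia.
  rewrite leqnn -leNgt => /(_ isT)/le_lt_trans; apply.
  by apply: k2r; lia.
have b1 : psum g k1 \is a fin_num.
  apply: psum_fin => // i ik; apply/eqP => gi.
  by have := gm i k; rewrite gi aE leye_eq => /(_ _)/eqP h; have := h ltac:(lia).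
have psE i : (k1 + i <= k2)%N -> psum g (k1 + i)%N = (fine (psum g k1) + a *+ i)%:E.
  elim: i => [|i IH] ik; first by rewrite addn0 addr0 fineK.
  rewrite addnS psumS IH; last by lia.
  have -> : g (k1 + i)%N = a%:E.
    apply/eqP; rewrite -aE eq_le; apply/andP; split.
      by rewrite leNgt; apply: k2l; lia.
    by apply: k1r; lia.
  by rewrite -EFinD mulrSr addrA.
have q1 := qv _ k1n v1; have q2 := qv _ k2n v2.
pose u : R := (k2 - k)%N%:R%R; pose v : R := (k - k1)%N%:R%R.
have u0 : (0 < u)%R by rewrite ltr0n subn_gt0.
have v0 : (0 < v)%R by rewrite ltr0n subn_gt0.
have t01 : (0 <= u / (u + v) <= 1)%R.
  rewrite divr_ge0 ?addr_ge0 ?(ltW u0) ?(ltW v0)//= ler_pdivrMr ?addr_gt0//.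
  by rewrite mul1r lerDl ltW.
have w0 : (0 < u + v)%R by rewrite addr_gt0.
have kE : (k%:R = k1%:R + v :> R)%R by rewrite /v natrB ?(ltnW k1k)// addrC subrK.
have k2E : (k2%:R = k1%:R + v + u :> R)%R.
  by rewrite -kE /u natrB ?(ltnW kk2)// [RHS]addrC subrK.
have := qconv (n - k1)%N%:R%R (n - k2)%N%:R%R _ t01.
have -> : (u / (u + v) * (n - k1)%:R + (1 - u / (u + v)) * (n - k2)%:R = (n - k)%:R)%R.
  rewrite (natrB _ k1n) (natrB _ k2n) (natrB _ (ltnW kn)) k2E kE.
  by field; exact: lt0r_neq0.
move/le_trans; apply.
have k12 := ltn_trans k1k kk2.
move: q1 q2; rewrite -[in psum g k2](subnKC (ltnW k12)) -[in psum g k](subnKC (ltnW k1k)).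
rewrite !psE ?subnKC ?(ltnW k12) ?(ltnW k1k) ?(ltnW kk2)//.
rewrite -{1}(fineK b1).
case: (q _) (qN (n - k1)%N%:R%R) => [r1| |]// _.
case: (q _) (qN (n - k2)%N%:R%R) => [r2| |]// _.
rewrite !lee_fin -!(mulr_natr a).
have -> : ((k2 - k1)%N%:R = u + v)%R.
  by rewrite natrB ?(ltnW k12)// k2E; ring.
rewrite -/v => q1 q2; rewrite -(ler_pM2l w0).
apply: (@le_trans _ _ (u * fine (psum g k1) + v * (fine (psum g k1) + a * (u + v))))%R.
  have -> : ((u + v) * (u / (u + v) * r1 + (1 - u / (u + v)) * r2) = u * r1 + v * r2)%R.
    by field; exact: lt0r_neq0.
  by rewrite lerD// ler_pM2l.
by rewrite le_eqVlt; apply/orP; left; apply/eqP; ring.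
Qed.

(** A convex minorant of one polynomial lies below it at the vertices, hence below [psum] everywhere
    and below the other one: the two suprema range over the same functions. *)
Lemma newton_spec_trop_hull P Q g : nondecr_roots g ->
  newton_spec P g -> newton_spec Q g -> forall k, trop_hull P k = trop_hull Q k.
Proof.
move=> ng.
suff H P' Q' : newton_spec P' g -> newton_spec Q' g -> forall q : R -> \bar R,
    (forall z, q z != -oo) -> convex_efun q ->
    (forall z, q z <= coef_fun P' z) -> forall z, q z <= coef_fun Q' z.
  move=> HP HQ k; rewrite /trop_hull /vex; congr ereal_sup.
  apply/seteqP; split => _ [q [qN qconv qle] <-]; exists q => //; split => //.
    exact: H HP HQ _ qN qconv qle.
  exact: H HQ HP _ qN qconv qle.
move=> [_ P1 P2] [_ Q1 Q2] q qN qconv /le_coef_fun qP; apply/le_coef_fun => k.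
apply: le_trans (Q1 k).
have kE : (n - (n - k))%N = k by rewrite subKn// -ltnS.
have := @convex_le_psum g q ng qN qconv _ (n - k)%N (leq_subr k n).
rewrite kE; apply => i iN vi; have iE : (n - (n - i))%N = i by rewrite subKn.
pose j : 'I_n.+1 := Ordinal (leq_subr i n : (n - i < n.+1)%N).
by have := qP j; rewrite (P2 j) /= iE.
Qed.

End TropicalUniqueness.

(** * Asymptotics along a filter at 0 *)

Definition epow (R : realType) (r e : R) : R[i] := (e `^ r)%:C.

(** The same notion as [simeq_pow] along any filter, since it is also applied to ultrafilters finer
    than [0^'+]. *)
Definition simeq (R : realType) (F : set_system R) (f : R -> R[i]) (a : R[i])
    (A : \bar R) : Prop :=
  match A with
  | r%:E => cvgc F (fun e => epow (- r) e * f e) a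
  | +oo%E => \forall e \near F, f e = 0
  | -oo%E => False
  end.

Section Epow.
Context {R : realType}.
Implicit Types (r s e : R) (f g : R -> R[i]) (a b : R[i]) (A B : \bar R).

Lemma simeq_powE f a A : simeq_pow f a A = simeq 0^'+ f a A.
Proof. by case: A => [r| |] //=; rewrite cvgcE. Qed.

Lemma epow0 e : epow 0 e = 1.
Proof. by rewrite /epow powRr0. Qed.

Lemma epowD e r s : 0 < e -> epow (r + s) e = epow r e * epow s e.
Proof.
by move=> e0; rewrite /epow powRD ?rmorphM//; apply/implyP => _; rewrite gt_eqF.
Qed.

Lemma epowNK e r : 0 < e -> epow (- r) e * epow r e = 1.
Proof. by move=> e0; rewrite -epowD// addNr epow0. Qed.

Lemma epowMn e r k : 0 < e -> epow (r *+ k) e = epow r e ^+ k.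
Proof.
move=> e0; elim: k => [|k IH]; first by rewrite mulr0n expr0 epow0.
by rewrite mulrS epowD// IH exprS.
Qed.

Lemma epow_sum e (I : Type) (t : seq I) (r : I -> R) : 0 < e ->
  epow (\sum_(i <- t) r i) e = \prod_(i <- t) epow (r i) e.
Proof.
move=> e0; elim: t => [|i t IH]; first by rewrite !big_nil epow0.
by rewrite !big_cons epowD// IH.
Qed.

Lemma normc_epow e r : normc (epow r e) = e `^ r.
Proof. by rewrite normc_real ger0_norm// powR_ge0. Qed.

Lemma epow_neq0 e r : 0 < e -> epow r e != 0.
Proof. by move=> e0; rewrite -normc_gt0 normc_epow powR_gt0. Qed.

Section Filter.
Context {F : set_system R} {FF : ProperFilter F}.
Hypothesis F0 : (0 : R)^'+ `<=` F.

Lemma near_gt0 : \forall e \near F, 0 < e.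
Proof. by apply: F0; exact: nbhs_right_gt. Qed.

Lemma near_lt e : 0 < e -> \forall x \near F, x < e.
Proof. by move=> e0; apply: F0; exact: nbhs_right_lt. Qed.

Lemma near_unit : \forall e \near F, 0 < e <= 1.
Proof.
by apply: filterS2 near_gt0 (near_lt ltr01) => e -> /ltW.
Qed.

Lemma cvgc_epow r : 0 < r -> cvgc F (epow r) 0.
Proof.
move=> r0; apply: (@cvgc_sub_filter _ _ 0^'+) => //.
exact: (@cvgc_real _ _ _ _ _ 0 (powR_cvg0 r0)).
Qed.

Lemma cvgc_epow_le r : 0 <= r -> cvgc F (epow r) (r == 0)%:R.
Proof.
rewrite le_eqVlt => /predU1P[<-|r0]; last by rewrite gt_eqF//; exact: cvgc_epow.
rewrite eqxx; have -> : epow 0 = (fun=> 1 : R[i]).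
  by apply: boolp.funext => e; rewrite epow0.
exact: cvgc_cst.
Qed.

Lemma simeq_neqNy f a A : simeq F f a A -> A != -oo%E.
Proof. by case: A. Qed.

Lemma simeqM f g a b A B : simeq F f a A -> simeq F g b B ->
  simeq F (fun e => f e * g e) (a * b) (A + B)%E.
Proof.
case: A B => [r| |] [s| |]//=; last 3 first.
- by move=> _; apply: filterS => e ->; rewrite mulr0.
- by move=> + _; apply: filterS => e ->; rewrite mul0r.
- by move=> + _; apply: filterS => e ->; rewrite mul0r.
move=> fa gb; apply: cvgc_near_eq (cvgcM fa gb).
by apply: filterS near_gt0 => e e0; rewrite opprD epowD//; ring.
Qed.

Lemma simeqD f g a b A : simeq F f a A -> simeq F g b A ->
  simeq F (fun e => f e + g e) (a + b) A.
Proof.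
case: A => [r| |]//=; last by apply: filterS2 => e -> ->; rewrite addr0.
by move=> fa gb; under eq_fun do rewrite mulrDr; exact: cvgcD.
Qed.

Lemma simeq_near_eq f g a A : (\forall e \near F, f e = g e) ->
  simeq F f a A -> simeq F g a A.
Proof.
case: A => [r| |]//= fg; last by apply: filterS2 fg => e ->.
by apply: cvgc_near_eq; apply: filterS fg => e ->.
Qed.

Lemma simeq_le f a A B : B != -oo%E -> (B <= A)%E -> simeq F f a A ->
  simeq F f (if B == A then a else 0) B.
Proof.
case: B A => [s| |] [r| |]//= _.
- rewrite lee_fin eqe => sr fa.
  have rs : 0 <= r - s by rewrite subr_ge0.
  have : cvgc F (fun e => epow (r - s) e * (epow (- r) e * f e)) ((r - s == 0)%:R * a).
    by apply: cvgcM fa; exact: cvgc_epow_le.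
  rewrite subr_eq0.
  rewrite [(_ == _)%:R * _](_ : _ = if s == r then a else 0); last first.
    by rewrite eq_sym; case: ifP; rewrite ?mul1r ?mul0r.
  apply: cvgc_near_eq; apply: filterS near_gt0 => e e0.
  by rewrite mulrA -epowD//; congr (epow _ _ * _); ring.
- move=> _ f0; apply: cvgc_near_eq (cvgc_cst _).
  by apply: filterS f0 => e ->; rewrite mulr0.
Qed.

Lemma simeq_cst (a : R[i]) : simeq F (fun=> a) a 0%E.
Proof.
apply: cvgc_near_eq (cvgc_cst _).
by apply: nearW => e; rewrite oppr0 epow0 mul1r.
Qed.

Lemma simeq_prod (I : Type) (t : seq I) (Q : pred I) (f : I -> R -> R[i])
    (a : I -> R[i]) (A : I -> \bar R) :
  (forall i, Q i -> simeq F (f i) (a i) (A i)) ->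
  simeq F (fun e => \prod_(i <- t | Q i) f i e) (\prod_(i <- t | Q i) a i)
    (\sum_(i <- t | Q i) A i)%E.
Proof.
move=> fa; elim: t => [|i t IH].
  by rewrite !big_nil; under eq_fun do rewrite big_nil; exact: simeq_cst.
rewrite !big_cons; under eq_fun do rewrite big_cons.
by case: (Q i) (fa i) => [/(_ isT) fi|_] //; exact: simeqM.
Qed.

Lemma simeq_sum (I : Type) (t : seq I) (Q : pred I) (f : I -> R -> R[i])
    (a : I -> R[i]) A : A != -oo%E ->
  (forall i, Q i -> simeq F (f i) (a i) A) ->
  simeq F (fun e => \sum_(i <- t | Q i) f i e) (\sum_(i <- t | Q i) a i) A.
Proof.
move=> AN fa; elim: t => [|i t IH].
  rewrite !big_nil; under eq_fun do rewrite big_nil.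
  have := @simeq_le (fun=> 0) 0 +oo%E A AN (leey _); rewrite if_same.
  by apply => /=; apply: nearW.
rewrite !big_cons; under eq_fun do rewrite big_cons.
by case: (Q i) (fa i) => [/(_ isT) fi|_] //; exact: simeqD.
Qed.

Lemma simeq_unique f a b r : simeq F f a r%:E -> simeq F f b r%:E -> a = b.
Proof. exact: cvgc_unique. Qed.

Lemma simeq_bounded f a r : simeq F f a r%:E ->
  \forall e \near F, normc (f e) <= (normc a + 1) * e `^ r.
Proof.
move=> /cvgc_bounded fb; apply: filterS2 near_gt0 fb => e e0.
rewrite normcM normc_epow powRN mulrC ler_pdivrMr// powR_gt0//.
Qed.

End Filter.
End Epow.

(** * Rescaled polynomials *)

Section Scaling.
Context {R : realType} {n : nat}.
Context {F : set_system R} {FF : ProperFilter F}.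
Hypothesis F0 : (0 : R)^'+ `<=` F.

(** The limit of the linear factor with root [y e^Y] under the substitution [x := e^a 'X], once
    divided by [e^min(a, Y)]. *)
Definition edge_factor (a : R) (y : R[i]) (Y : \bar R) : {poly R[i]} :=
  if (Y < a%:E)%E then (- y)%:P else if Y == a%:E then 'X - y%:P else 'X.

(** After rescaling, the term [j] has order [P j + a *+ j - M >= 0]; only those of order 0 survive,
    and they are the terms of the edge polynomial. *)
Lemma scaled_sum_cvg (calP : 'I_n.+1 -> R -> R[i]) (p : {poly R[i]})
    (P : 'I_n.+1 -> \bar R) (a M : R) (x : R -> R[i]) (w : R[i]) :
  (forall j : 'I_n.+1, simeq F (calP j) p`_j (P j)) -> trop_eval P a%:E = M%:E ->
  cvgc F x w ->
  cvgc F (fun e => epow (- M) e * \sum_j calP j e * (epow a e * x e) ^+ j)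
    (edge_poly p P a).[w].
Proof.
move=> cP PM xw; rewrite /edge_poly horner_sum big_mkcond /=.
under eq_fun do rewrite mulr_sumr.
apply: cvgc_sum => j _.
have := trop_eval_le P a%:E j; have := cP j; rewrite PM fin_enatmul.
case: (P j) => [s| |] //=; last first.
  move=> cP0 _; apply: cvgc_near_eq (cvgc_cst _).
  by apply: filterS cP0 => e ->; rewrite mul0r mulr0.
rewrite -EFinD lee_fin eqe => cPs Ms.
have Ms' : 0 <= s + a *+ j - M by rewrite subr_ge0.
have -> : (if M == s + a *+ j then (p`_j *: 'X^j).[w] else 0) =
    p`_j * (s + a *+ j - M == 0)%:R * w ^+ j.
  rewrite subr_eq0 eq_sym; case: ifP => _; last by rewrite mulr0 mul0r.
  by rewrite mulr1 hornerZ hornerXn.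
apply: (@cvgc_near_eq _ _ _ _ (fun e => (epow (- s) e * calP j e) *
    epow (s + a *+ j - M) e * x e ^+ j)).
  apply: filterS (near_gt0 F0) => e e0.
  rewrite !epowD// exprMn epowMn//.
  by rewrite -[RHS]mul1r -(epowNK s e0); ring.
by apply: cvgcM; [apply: cvgcM => //; exact: cvgc_epow_le|exact: cvgcX].
Qed.

Lemma scaled_prod_cvg (f : 'I_n -> R -> R[i]) (y : 'I_n -> R[i])
    (Y : 'I_n -> \bar R) (a : R) (x : R -> R[i]) (w : R[i]) :
  (forall j, simeq F (f j) (y j) (Y j)) -> cvgc F x w ->
  cvgc F (fun e => epow (- \sum_j fine (mine a%:E (Y j))) e *
                   \prod_j (epow a e * x e - f j e))
    (\prod_j edge_factor a (y j) (Y j)).[w].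
Proof.
move=> fY xw; rewrite horner_prod.
apply: (@cvgc_near_eq _ _ _ _ (fun e => \prod_j (epow (- fine (mine a%:E (Y j))) e *
   (epow a e * x e - f j e)))).
  by apply: filterS (near_gt0 F0) => e e0; rewrite -sumrN epow_sum// big_split.
apply: cvgc_prod => j _; have := fY j; rewrite /edge_factor.
case: (Y j) => [s| |] //=; last first.
  move=> f0; rewrite hornerX; apply: cvgc_near_eq xw.
  apply: filterS2 (near_gt0 F0) f0 => e e0 ->.
  by rewrite miney /= subr0 mulrA (epowNK a e0) mul1r.
rewrite lte_fin eqe -EFin_min /= => fs.
case: (ltgtP s a) => [sa|sa|sa].
- rewrite hornerC -[- y j]add0r -[0](mul0r w).
  apply: (@cvgc_near_eq _ _ _ _ (fun e => epow (a - s) e * x e - epow (- s) e * f j e)).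
    by apply: filterS (near_gt0 F0) => e e0; rewrite [a - s]addrC epowD// mulrBr mulrA.
  apply: cvgcB => //; apply: cvgcM => //; apply: cvgc_epow => //.
  by rewrite subr_gt0.
- rewrite hornerX -[w]subr0 -[X in w - X](mul0r (y j)).
  apply: (@cvgc_near_eq _ _ _ _ (fun e => x e - epow (s - a) e * (epow (- s) e * f j e))).
    apply: filterS (near_gt0 F0) => e e0; rewrite mulrBr !mulrA (epowNK a e0) mul1r.
    by rewrite -(epowD (s - a) (- s) e0) addrAC subrr add0r.
  apply: cvgcB => //; apply: cvgcM => //; apply: cvgc_epow => //.
  by rewrite subr_gt0.
- rewrite hornerXsubC -sa.
  apply: (@cvgc_near_eq _ _ _ _ (fun e => x e - epow (- s) e * f j e)).
    by apply: filterS (near_gt0 F0) => e e0; rewrite mulrBr !mulrA (epowNK s e0) mul1r.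
  exact: cvgcB.
Qed.

(** At every [w] both sides are the limit of the same rescaled polynomial, computed once from the
    coefficients and once from the roots; the normalizations agree since the two tropical values
    do. *)
Lemma edge_poly_prod (calP : 'I_n.+1 -> R -> R[i]) (p : {poly R[i]})
    (P : 'I_n.+1 -> \bar R) (f : 'I_n -> R -> R[i]) (y : 'I_n -> R[i])
    (Y : 'I_n -> \bar R) (a : R) :
  (forall j : 'I_n.+1, simeq F (calP j) p`_j (P j)) ->
  (forall j, simeq F (f j) (y j) (Y j)) ->
  trop_eval P a%:E = (\sum_j mine a%:E (Y j))%E ->
  (\forall e \near F, forall x, \sum_j calP j e * x ^+ j = \prod_j (x - f j e)) ->
  edge_poly p P a = \prod_j edge_factor a (y j) (Y j).
Proof.
move=> cP fY PY calPf; apply: poly_eq_horner => w.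
have PM : trop_eval P a%:E = (\sum_j fine (mine a%:E (Y j)))%:E.
  rewrite PY -sumEFin; apply: eq_bigr => j _.
  have := simeq_neqNy (fY j).
  by case: (Y j) => [s| |]// _; rewrite ?miney// -EFin_min.
apply: (@cvgc_unique _ _ F _ _ _ _ (scaled_sum_cvg cP PM (cvgc_cst w))).
apply: cvgc_near_eq (scaled_prod_cvg a fY (cvgc_cst w)).
by apply: filterS calPf => e ->.
Qed.

End Scaling.

(** * The exponent of a germ *)

Section Exponent.
Context {R : realType}.
Implicit Types (f : R -> R[i]) (t r : R).

(** Division by [ln e < 0] reverses the inequality. Where [f e = 0] the quotient is [-oo] divided by
    a negative number, that is [+oo]. *)
Lemma exponent_ratio_ge f t (e : R) : 0 < e < 1 -> normc (f e) <= e `^ t ->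
  (t%:E <= lne (normc (f e))%:E / (ln e)%:E)%E.
Proof.
move=> /andP[e0 e1] fe; have lne0 : ln e < 0 by exact: ln_lt0 (introT andP (conj e0 e1)).
rewrite inver lt_eqF//.
have [f0|f0] := eqVneq (normc (f e)) 0.
  rewrite f0 le0_lneNy//= mulNyr ltr0_sg ?invr_lt0// mulN1e leey//.
have f0' : 0 < normc (f e) by rewrite lt_def f0 normc_ge0.
rewrite lne_EFin// -EFinM lee_fin ler_ndivlMr//.
by rewrite -ln_powR ler_ln ?posrE ?powR_gt0.
Qed.

Lemma exponent_ratio_le f t (e : R) : 0 < e < 1 -> e `^ t <= normc (f e) ->
  (lne (normc (f e))%:E / (ln e)%:E <= t%:E)%E.
Proof.
move=> /andP[e0 e1] fe; have lne0 : ln e < 0 by exact: ln_lt0 (introT andP (conj e0 e1)).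
rewrite inver lt_eqF//.
have f0' : 0 < normc (f e) by apply: lt_le_trans fe; exact: powR_gt0.
rewrite lne_EFin// -EFinM lee_fin ler_ndivrMr//.
by rewrite -ln_powR ler_ln ?posrE ?powR_gt0.
Qed.

Lemma near01 : \forall e \near (0 : R)^'+, 0 < e < 1.
Proof.
by apply: filterS2 (nbhs_right_gt _) (nbhs_right_lt ltr01) => e -> ->.
Qed.

Lemma exponent_ge f t : (\forall e \near 0^'+, normc (f e) <= e `^ t) ->
  (t%:E <= exponent f)%E.
Proof.
move=> ft; rewrite /exponent limf_einfE; apply: ereal_sup_ge.
eexists.
  exists [set e | 0 < e < 1 /\ normc (f e) <= e `^ t] => //.
  exact: filterI near01 ft.
apply: le_ereal_inf_tmp => _ [e [e01 fe] <-]; exact: exponent_ratio_ge.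
Qed.

Lemma exponent_le f t : (\forall e \near 0^'+, e `^ t <= normc (f e)) ->
  (exponent f <= t%:E)%E.
Proof.
move=> ft; rewrite /exponent limf_einfE; apply: ge_ereal_sup => _ [V FV <-].
have [e [[e01 fe] Ve]] := filter_ex (filterI (filterI near01 ft) FV).
apply: (@le_trans _ _ (lne (normc (f e))%:E / (ln e)%:E)%E).
  by apply: ereal_inf_lbound; exists e.
exact: exponent_ratio_le.
Qed.

Lemma simeq_exponent_ge f a A : simeq 0^'+ f a A -> (A <= exponent f)%E.
Proof.
case: A => [r| |] //= fa.
  (* The constant [normc a + 1] is absorbed by an arbitrarily small loss [d] in the exponent, as
     [e^d] tends to 0. *)
  apply/lee_addgt0Pr => d d0; rewrite -leeBlDr// -EFinB; apply: exponent_ge.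
  have fb : \forall e \near 0^'+, normc (f e) <= (normc a + 1) * e `^ r.
    exact: simeq_bounded fa.
  have C0 : 0 < normc a + 1 by rewrite ltr_wpDl ?normc_ge0.
  have /cvgrPdist_lt /(_ _ (divr_gt0 ltr01 C0)) dC := powR_cvg0 d0.
  apply: filterS2 (filterI near01 fb) dC => e [/andP[e0 _] fe].
  rewrite sub0r normrN ger0_norm ?powR_ge0// ltr_pdivlMr// => ed.
  apply: le_trans fe _; rewrite -[r in leLHS](subrK d) powRD; last first.
    by apply/implyP => _; rewrite gt_eqF.
  by rewrite mulrCA ler_piMr ?powR_ge0// mulrC ltW.
rewrite leye_eq; apply/eqP; rewrite /exponent limf_einfE; apply/eqP; rewrite -leye_eq.
apply: ereal_sup_ge.
eexists; first by exists [set e | 0 < e < 1 /\ f e = 0] => //; exact: filterI near01 fa.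
apply: le_ereal_inf_tmp => _ [e [/andP[e0 e1] ->] <-].
rewrite normc0 le0_lneNy// inver lt_eqF ?mulNyr; last by apply: ln_lt0; rewrite e0.
by rewrite ltr0_sg ?mulN1e// invr_lt0; apply: ln_lt0; rewrite e0.
Qed.

Lemma simeq_exponent f a A : simeq 0^'+ f a A -> a != 0 \/ A = +oo%E ->
  exponent f = A.
Proof.
move=> fa aA; apply/eqP; rewrite eq_le (simeq_exponent_ge fa) andbT.
case: A fa aA => [r| |] //= fa; last by rewrite leey.
case=> // a0; apply/lee_addgt0Pr => d d0; rewrite -EFinD; apply: exponent_le.
have a2 : 0 < normc a / 2 by rewrite divr_gt0// normc_gt0.
have /cvgrPdist_lt /(_ _ a2) dC := powR_cvg0 d0.
move/cvgcP : (fa) => /(_ _ a2) fa2.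
apply: filterS2 (filterI near01 fa2) dC => e [/andP[e0 _] fe].
rewrite sub0r normrN ger0_norm ?powR_ge0// => ed.
have : normc a / 2 <= normc (epow (- r) e * f e).
  have := normc_triangle a (epow (- r) e * f e) 0; rewrite !subr0 normc_distC.
  by move: fe; lra.
rewrite normcM normc_epow powRN [(e `^ r)^-1 * _]mulrC ler_pdivlMr ?powR_gt0// => h.
apply: le_trans h; rewrite powRD; last by apply/implyP => _; rewrite gt_eqF.
by rewrite mulrC ler_wpM2r ?powR_ge0// ltW.
Qed.

End Exponent.

(** * Scales of the roots *)

Section RootScale.
Context {R : realType} {n : nat} {U : set_system R} {UU : UltraFilter U}.
Hypothesis U0 : (0 : R)^'+ `<=` U.

(** Along an ultrafilter, a function that is not eventually bounded by [M] eventually exceeds [M],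
    so an unbounded one diverges. *)
Lemma ultra_trichotomy (f : R -> R[i]) :
  [\/ cvgc U f 0, forall M, \forall e \near U, M < normc (f e) |
      exists2 w, w != 0 & cvgc U f w].
Proof.
have [[M fM]|fM] := pselect (exists M, \forall e \near U, normc (f e) <= M).
  have [w fw] := ultra_bounded_cvg fM.
  by have [w0|w0] := eqVneq w 0; [constructor 1; rewrite -w0|constructor 3; exists w].
constructor 2 => M.
have [UM|] := in_ultra_setVsetC [set e | normc (f e) <= M] UU.
  by exfalso; apply: fM; exists M.
by apply: filterS => e /= /negP; rewrite -ltNge.
Qed.

Lemma cvgc_inv_diverge (f : R -> R[i]) :
  (forall M, \forall e \near U, M < normc (f e)) -> cvgc U (fun e => (f e)^-1) 0.
Proof.
move=> fM; apply/cvgcP => d d0.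
apply: filterS (fM d^-1) => e de; rewrite subr0 normcV.
have f0 : 0 < normc (f e) by apply: lt_trans de; rewrite invr_gt0.
by rewrite -[d]invrK ltf_pV2 ?posrE ?invr_gt0.
Qed.

(* A root of size between two consecutive scales [e^c_k] and [e^c_{k+1}] would
   leave the term of the vertex [k] of the Newton polygon unbalanced. *)
Lemma root_scale (calP : 'I_n.+1 -> R -> R[i]) (p : {poly R[i]})
    (P : 'I_n.+1 -> \bar R) (g : nat -> \bar R) (z : R -> R[i]) :
  nondecr_roots g -> newton_spec P g ->
  (forall j : 'I_n.+1, simeq U (calP j) p`_j (P j)) ->
  (forall j : 'I_n.+1, vertex n g (n - j)%N -> P j != +oo%E -> p`_j != 0) ->
  (\forall e \near U, \sum_j calP j e * z e ^+ j = 0) ->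
  (\forall e \near U, z e = 0) \/
  exists a : R, (exists2 i, (i < n)%N & g i = a%:E) /\
  exists w, [/\ w != 0, cvgc U (fun e => epow (- a) e * z e) w &
                root (edge_poly p P a) w].
Proof.
move=> ng Pg cP pv Pz.
have Pe y := newton_spec_eval y ng Pg.
have edge_root (a : R) w : cvgc U (fun e => epow (- a) e * z e) w ->
    root (edge_poly p P a) w.
  move=> zw; have Pfin : trop_eval P a%:E \is a fin_num.
    by rewrite Pe min_sum_fin.
  have PM : trop_eval P a%:E = (fine (trop_eval P a%:E))%:E by rewrite fineK.
  apply/rootP; apply: (@cvgc_unique _ _ U _ _ _ _ (scaled_sum_cvg U0 cP PM zw)).
  apply: cvgc_near_eq (cvgc_cst _).
  apply: filterS2 (near_gt0 U0) Pz => e e0 ze.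
  transitivity (epow (- fine (trop_eval P a%:E)) e * \sum_j calP j e * z e ^+ j).
    by rewrite ze mulr0.
  congr (_ * _); apply: eq_bigr => j _; congr (_ * _ ^+ _).
  by rewrite mulrA -(epowD a (- a) e0) subrr epow0 mul1r.
have [UZ|UnZ] := in_ultra_setVsetC [set e | z e = 0] UU; [by left|right].
have {}UnZ : \forall e \near U, z e != 0 by apply: filterS UnZ => e /= /eqP.
pose dvg (a : R) := forall M, \forall e \near U, M < normc (epow (- a) e * z e).
have [|none] := pselect (exists a : R, (exists2 i, (i < n)%N & g i = a%:E) /\
    exists2 w, w != 0 & cvgc U (fun e => epow (- a) e * z e) w).
  move=> [a [ga [w w0 zw]]]; exists a; split => //; exists w; split => //.
  exact: edge_root.
exfalso.
have dvg_le a b : a <= b -> dvg a -> dvg b.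
  move=> ab da M; apply: filterS2 (near_unit U0) (da M) => e /andP[e0 e1] /lt_le_trans; apply.
  rewrite !normcM !normc_epow ler_wpM2r ?normc_ge0//.
  by apply: ger_powR; rewrite ?e0// lerN2.
(* The predicate selects the scales that [z] exceeds by an unbounded factor, together with [+oo]; by
   [dvg_le] it is upward closed and cuts the roots at some [k]. *)
pose pr (x : \bar R) := `[< x = +oo%E \/ exists2 a, x = a%:E & dvg a >].
have [|k kn [k1 k2]] := @find_threshold _ n g pr ng.
  move=> x y /asboolP xd xy; apply/asboolP; move: xd xy => [->|[a -> da]].
    by rewrite leye_eq => /eqP; left.
  case: y => [b| |]// ab; last by left.
  by right; exists b => //; apply: dvg_le da.
have cvg0 i a : (i < k)%N -> g i = a%:E -> cvgc U (fun e => epow (- a) e * z e) 0.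
  move=> ik ga; have := ultra_trichotomy (fun e => epow (- a) e * z e).
  case=> // [da|w0]; exfalso.
    by have /asboolP := k1 _ ik; apply; right; exists a.
  by apply: none; exists a; split => //; exists i => //; exact: leq_trans ik kn.
have dvgk i a : (k <= i < n)%N -> g i = a%:E -> dvg a.
  by move=> ik ga; have /asboolP := k2 _ ik; rewrite ga => -[//|[b [->]]].
have gfin i : (i < k)%N -> g i != +oo%E.
  by move=> ik; apply/eqP => gi; have /asboolP := k1 _ ik; apply; left.
have vk : vertex n g k.
  rewrite /vertex; have [//|k0] := eqVneq k 0%N.
  have [//|kn'] /= := eqVneq k n.
  have k0' : (0 < k)%N by rewrite lt0n.
  have kN : (k < n)%N by rewrite ltn_neqAle kn'.
  rewrite lt_neqAle; case: ng => gm _; rewrite gm ?leq_pred// andbT.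
  apply/eqP => gk; have := k1 k.-1; rewrite prednK// leqnn gk => /(_ isT)/negP; apply.
  by apply: k2; rewrite leqnn.
have bfin := psum_fin ng gfin; set b := fine (psum g k).
have bE : psum g k = b%:E by rewrite fineK.
pose m : 'I_n.+1 := Ordinal (leq_subr k n : (n - k < n.+1)%N).
have mk : (n - m)%N = k by rewrite subKn.
have Pm : P m = b%:E by rewrite -bE; case: Pg => _ _ ->; rewrite mk.
have pm0 : p`_m != 0 by apply: pv; [rewrite mk|rewrite Pm].
(* The terms of the equation divided by the monomial [e^b z^m] of the vertex. Their sum vanishes
   while [T m] tends to [p_m != 0]: a contradiction once all the others tend to 0. *)
pose T (j : 'I_n.+1) e := epow (- b) e * z e ^- m * (calP j e * z e ^+ j).
have Tm : cvgc U (T m) p`_m.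
  have := cP m; rewrite Pm /=; apply: cvgc_near_eq.
  apply: filterS UnZ => e ze; rewrite /T; have := expf_neq0 m ze.
  by move: (z e ^+ m) (epow (- b) e) (calP m e) => Z B c Z0; field.
suff T0 j : j != m -> cvgc U (T j) 0.
  have : cvgc U (fun e => \sum_j T j e) p`_m.
    have -> : p`_m = p`_m + \sum_(j < n.+1 | j != m) 0 by rewrite big1// addr0.
    apply: (@cvgc_near_eq _ _ _ _ (fun e => T m e + \sum_(j | j != m) T j e)).
      by apply: nearW => e; rewrite [RHS](bigD1 m).
    by apply: cvgcD => //; apply: cvgc_sum => j; exact: T0.
  move=> Tp; move/eqP: pm0; apply; apply: (cvgc_unique Tp).
  apply: cvgc_near_eq (cvgc_cst 0).
  by apply: filterS Pz => e ze; rewrite -mulr_sumr ze mulr0.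
have gj a (i : 'I_n.+1) s : min_sum n g a%:E = (b + a *+ m)%:E ->
    P i = s%:E -> 0 <= s + a *+ i - (b + a *+ m).
  move=> ga Pj; have := trop_eval_le P a%:E i.
  by rewrite Pe ga Pj fin_enatmul -EFinD lee_fin subr_ge0.
move=> jm; have := cP j; case Pj: (P j) => [s| |]//=; last first.
  move=> cP0; apply: cvgc_near_eq (cvgc_cst _).
  by apply: filterS cP0 => e; rewrite /T => ->; rewrite mul0r mulr0.
move=> cPs.
have [jm'|mj|/val_inj jm'] := ltngtP j m; last by rewrite jm' eqxx in jm.
  (* For [j < m] use the next scale [a = g k], which is finite as [P j] is: [e^-a z] diverges and
     enters to the negative power [j - m]. *)
  have kN : (k < n)%N by move: jm'; rewrite /= ltn_subRL; lia.
  have kj : (k < n - j)%N by move: jm'; rewrite /=; lia.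
  have [a ga] : exists a, g k = a%:E.
    have [_ /(_ j) Pj' _] := Pg; have := psum_eqy ng kj.
    case gk : (g k) => [a| |]; [by exists a| |by case: ng => _ /(_ k); rewrite gk].
    by move=> /(_ erefl) pj; move: Pj'; rewrite pj Pj.
  have da : dvg a by apply: dvgk ga; rewrite leqnn.
  have {}ga : min_sum n g a%:E = (b + a *+ m)%:E.
    rewrite (@min_sumE _ _ g _ k)// ?bE ?fin_enatmul ?EFinD// => i.
      by move=> /ltnW ik; rewrite -ga; case: ng => gm _; exact: gm.
    by move=> /andP[ki _]; rewrite -ga; case: ng => gm _; exact: gm.
  have d0 := gj _ _ _ ga Pj.
  pose d := (m - j)%N.
  have dm : m = (d + j)%N :> nat by rewrite subnK// ltnW.
  rewrite -(mulr0 (p`_j * (s + a *+ j - (b + a *+ m) == 0)%:R)).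
  rewrite -[X in _ * X](_ : 0 ^+ d = 0); last by rewrite expr0n subn_eq0 leqNgt jm'.
  apply: (@cvgc_near_eq _ _ _ _ (fun e => epow (- s) e * calP j e *
      epow (s + a *+ j - (b + a *+ m)) e * (epow (- a) e * z e)^-1 ^+ d)); last first.
    apply: cvgcM; last by apply: cvgcX; exact: cvgc_inv_diverge.
    by apply: cvgcM => //; exact: cvgc_epow_le.
  apply: filterS2 (near_gt0 U0) UnZ => e e0 ze.
  have -> : s + a *+ j - (b + a *+ m) = s + (- b + (- a) *+ d).
    by rewrite dm mulrnDr mulNrn; ring.
  rewrite (epowD _ _ e0) (epowD (- b) _ e0) (epowMn _ _ e0) /T dm exprD exprVn exprMn.
  have A0 := expf_neq0 d (epow_neq0 (- a) e0).
  have Z0 := expf_neq0 d ze; have Z1 := expf_neq0 j ze.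
  have uv := epowNK s e0.
  move: A0 Z0 Z1 uv.
  move: (epow (- a) e ^+ d) (z e ^+ d) (z e ^+ j) (epow (- s) e)
    (epow s e) (epow (- b) e) (calP j e).
  move=> A Zd Zj u v B c A0 Z0 Z1 uv.
  by rewrite -[RHS]mul1r -uv; field; rewrite A0 Z0 Z1.
(* For [j > m] use the previous scale [a = g k.-1]: [e^-a z] tends to 0 and enters to the positive
   power [j - m]. *)
have k0 : (0 < k)%N by move: mj (ltn_ord j) => /=; lia.
have [a ga] : exists a, g k.-1 = a%:E.
  exists (fine (g k.-1)); rewrite fineK// fin_numE.
  by rewrite gfin ?prednK// andbT; case: ng => _.
have a0 : cvgc U (fun e => epow (- a) e * z e) 0 by apply: cvg0 ga; rewrite prednK.
have {}ga : min_sum n g a%:E = (b + a *+ m)%:E.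
  rewrite (@min_sumE _ _ g _ k)// ?bE ?fin_enatmul ?EFinD// => i.
    by move=> ik; rewrite -ga; case: ng => gm _; apply: gm; rewrite -ltnS prednK.
  move=> /andP[ki _]; rewrite -ga; case: ng => gm _; apply: gm.
  exact: leq_trans (leq_pred _) ki.
have d0 := gj _ _ _ ga Pj.
pose d := (j - m)%N.
have dm : j = (m + d)%N :> nat by rewrite subnKC// ltnW.
rewrite -(mulr0 (p`_j * (s + a *+ j - (b + a *+ m) == 0)%:R)).
rewrite -[X in _ * X](_ : 0 ^+ d = 0); last by rewrite expr0n subn_eq0 leqNgt mj.
apply: (@cvgc_near_eq _ _ _ _ (fun e => epow (- s) e * calP j e *
    epow (s + a *+ j - (b + a *+ m)) e * (epow (- a) e * z e) ^+ d)); last first.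
  apply: cvgcM; last exact: cvgcX.
  by apply: cvgcM => //; exact: cvgc_epow_le.
apply: filterS2 (near_gt0 U0) UnZ => e e0 ze.
have -> : s + a *+ j - (b + a *+ m) = s + (- b + a *+ d).
  by rewrite dm mulrnDr; ring.
rewrite (epowD _ _ e0) (epowD (- b) _ e0) (epowMn _ _ e0) /T dm exprD exprMn.
have Z1 := expf_neq0 m ze.
have uv := epowNK s e0.
have AE : epow (- a) e ^+ d * epow a e ^+ d = 1 by rewrite -exprMn epowNK// expr1n.
move: Z1 uv AE.
move: (epow (- a) e ^+ d) (epow a e ^+ d) (z e ^+ d) (z e ^+ m) (epow (- s) e)
  (epow s e) (epow (- b) e) (calP j e).
move=> A E Zd Zm u v B c Z1 uv AE.
by rewrite -[RHS]mul1r -uv -[RHS]mul1r -AE; field.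
Qed.

End RootScale.

(** * Limits of continuous branches *)

Lemma near_all (T : Type) (F : set_system T) {FF : Filter F} (I : eqType)
    (s : seq I) (Q : I -> T -> Prop) :
  (forall i, i \in s -> \forall x \near F, Q i x) ->
  \forall x \near F, forall i, i \in s -> Q i x.
Proof.
elim: s => [|i s IH] H; first by apply: (filterS _ filterT).
have Hi := H i (mem_head _ _).
have Hs : \forall x \near F, forall i, i \in s -> Q i x.
  by apply: IH => k ks; apply: H; rewrite inE ks orbT.
by apply: filterS2 Hi Hs => x Qi Qs k; rewrite inE => /predU1P[->|/Qs].
Qed.

Section LocallyConstant.
Context {R : realType}.

Lemma right_nbhs_interval (Q : R -> Prop) : (\forall e \near 0^'+, Q e) ->
  exists2 e1 : R, 0 < e1 & forall e, 0 < e < e1 -> Q e.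
Proof.
move=> [r /= r0 rQ]; exists r => // e /andP[e0 er].
by apply: rQ => //=; rewrite sub0r normrN gtr0_norm.
Qed.

Lemma locally_constant (V : Type) (h : R -> V) (e1 : R) :
  (forall t, 0 < t < e1 -> \forall s \near t, h s = h t) ->
  forall s t, 0 < s < e1 -> 0 < t < e1 -> h s = h t.
Proof.
move=> hc s t sI tI.
pose I := [set x : R | 0 < x < e1].
have oI : open I.
  have -> : I = `]0, e1[%classic by apply/seteqP; split => x; rewrite /I /= in_itv.
  exact: interval_open.
have cI : connected I.
  have -> : I = `]0, e1[%classic by apply/seteqP; split => x; rewrite /I /= in_itv.
  apply/connected_intervalP; exact: interval_is_interval.
pose B := [set x | I x /\ h x = h t].
have oB : open B.
  rewrite openE => x [Ix hx]; have := hc x Ix.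
  have := open_nbhs_nbhs (conj oI Ix).
  by apply: filterS2 => y Iy hy; split => //; rewrite hy.
have oB' : open (I `\` B).
  rewrite openE => x [Ix hx]; have := hc x Ix.
  have := open_nbhs_nbhs (conj oI Ix).
  apply: filterS2 => y Iy hy; split => // -[_ hy']; apply: hx; split => //.
  by rewrite -hy.
suff BI : B = I by have : I s by []; rewrite -BI => -[].
apply: cI; first by exists t.
- by exists B => //; apply/seteqP; split => x; [case|case].
- exists (~` (I `\` B)); first exact: open_closedC.
  apply/seteqP; split => x; first by move=> Bx; split; [case: Bx|case].
  by move=> [Ix nB]; apply: contrapT => nBx; exact: nB.
Qed.

End LocallyConstant.

Section BranchAsymptotics.
Context {R : realType}.
Implicit Types (tau : R[i] * \bar R) (f : R -> R[i]) (d e : R) (z : R[i]).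

(** A possible leading term: coefficient and exponent. The zero germ is encoded by [(0, +oo)] alone,
    so that distinct targets are distinct asymptotics. *)
Definition target tau := (tau.2 \is a fin_num /\ tau.1 != 0) \/
  (tau.2 = +oo%E /\ tau.1 = 0).

(** Both conditions are closed in [z], so that failing to be near a target is an open condition. *)
Definition near_target d tau e z : Prop :=
  if tau.2 is a%:E then normc (epow (- a) e * z - tau.1) <= d else z = 0.

Lemma near_targetW d d' tau e z : d <= d' ->
  near_target d tau e z -> near_target d' tau e z.
Proof.
rewrite /near_target; case: tau.2 => // a dd' /le_trans; exact.
Qed.

Lemma simeq_near_target (F : set_system R) {FF : Filter F} f tau d : 0 < d ->
  simeq F f tau.1 tau.2 -> \forall e \near F, near_target d tau e (f e).
Proof.
move=> d0; rewrite /near_target; case: tau.2 => // a /= /cvgcP /(_ _ d0).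
by apply: filterS => e /ltW.
Qed.

(** With equal exponents the coefficients differ and are separated by their distance. With [a < a'],
    a point near the second target satisfies [e^-a z = O(e^(a' - a))], which is too small to be near
    [w != 0]; so is [z = 0]. *)
Lemma near_target_separated tau tau' : target tau -> target tau' -> tau != tau' ->
  \forall d \near (0 : R)^'+, \forall e \near (0 : R)^'+,
    forall z, near_target d tau e z -> ~ near_target d tau' e z.
Proof.
have main tau1 tau2 : target tau1 -> target tau2 -> (tau1.2 <= tau2.2)%E ->
    tau1 != tau2 -> exists2 d : R, 0 < d & \forall e \near (0 : R)^'+,
    forall z, near_target d tau1 e z -> ~ near_target d tau2 e z.
  case: tau1 tau2 => [w A] [w' A']; rewrite /target /near_target /=.
  case: A A' => [a| |] [a'| |]; try by [case=> -[]|move=> _; case=> -[]].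
  - case=> [[_ w0]|[]//] [[_ w'0]|[]//]; rewrite lee_fin le_eqVlt => /predU1P[<-|aa'] ww'.
      have {ww'} ww' : w != w' by apply: contra_neq ww' => ->.
      have ww : 0 < normc (w - w') by rewrite normc_gt0 subr_eq0.
      exists (normc (w - w') / 3); first by rewrite divr_gt0.
      apply: nearW => e z h1 h2.
      have := normc_triangle w (epow (- a) e * z) w'.
      by rewrite [in X in _ <= X + _]normc_distC; lra.
    have w0' : 0 < normc w by rewrite normc_gt0.
    exists (normc w / 3); first by rewrite divr_gt0.
    have C0 : 0 < normc w' + normc w by rewrite ltr_wpDl ?normc_ge0.
    have aa0 : 0 < a' - a by rewrite subr_gt0.
    have c0 : 0 < normc w / (3 * (normc w' + normc w)) by rewrite divr_gt0// mulr_gt0.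
    have /cvgrPdist_lt /(_ _ c0) dC := powR_cvg0 aa0.
    apply: filterS2 (nbhs_right_gt _) dC => e e0.
    rewrite sub0r normrN ger0_norm ?powR_ge0// ltr_pdivlMr ?mulr_gt0// => eC z h1 h2.
    have zE : epow (- a) e * z = epow (a' - a) e * (epow (- a') e * z).
      by rewrite mulrA -(epowD _ _ e0); congr (epow _ _ * _); ring.
    have h3 : normc (epow (- a') e * z) <= normc w' + normc w.
      have := normc_triangle (epow (- a') e * z) w' 0; rewrite !subr0.
      by move: h2; lra.
    have h4 : normc (epow (- a) e * z) <= e `^ (a' - a) * (normc w' + normc w).
      by rewrite zE normcM normc_epow ler_wpM2l ?powR_ge0.
    have := normc_triangle w (epow (- a) e * z) 0; rewrite !subr0 normc_distC.
    by move: h1 h4 eC; set u := _ * (_ + _); rewrite mulrCA -/u; lra.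
  - case=> [[_ w0]|[]//] _ _ _.
    have w0' : 0 < normc w by rewrite normc_gt0.
    exists (normc w / 2); first by rewrite divr_gt0.
    apply: nearW => e z + z0; rewrite z0 mulr0 sub0r normcN; lra.
  - by case=> [[]//|[_ ->]] [[]//|[_ ->]] _; rewrite eqxx.
move=> t1 t2 t12.
have [d d0 H] : exists2 d : R, 0 < d & \forall e \near (0 : R)^'+,
    forall z, near_target d tau e z -> ~ near_target d tau' e z.
  have [le|/ltW le] := leP tau.2 tau'.2; first exact: main.
  rewrite eq_sym in t12; have [d d0 H] := main _ _ t2 t1 le t12.
  by exists d => //; apply: filterS H => e He z h1 h2; exact: He h2 h1.
apply: filterS (nbhs_right_lt d0) => d' /ltW d'd.
apply: filterS H => e He z h1 h2.
exact: (He z (near_targetW d'd h1) (near_targetW d'd h2)).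
Qed.

Lemma cvgc_epow_at (a t : R) : 0 < t -> cvgc (nbhs t) (epow a) (epow a t).
Proof.
move=> t0; apply: cvgc_real.
have : derivable (fun x => x `^ a) t 1 by apply: derivable_powR; rewrite in_itv/= t0.
by move=> /derivable1_diffP /differentiable_continuous.
Qed.

Lemma near_not_target d tau f (t : R) : 0 < t -> cvgc (nbhs t) f (f t) ->
  ~ near_target d tau t (f t) ->
  \forall s \near t, ~ near_target d tau s (f s).
Proof.
move=> t0 ft; rewrite /near_target; case: tau.2 => [a| |]; last 2 first.
- move/eqP; rewrite -normc_gt0 => ft0; move/cvgcP: ft => /(_ _ ft0).
  by apply: filterS => s + fs; rewrite fs sub0r normcN ltxx.
- move/eqP; rewrite -normc_gt0 => ft0; move/cvgcP: ft => /(_ _ ft0).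
  by apply: filterS => s + fs; rewrite fs sub0r normcN ltxx.
move=> /negP; rewrite -ltNge => dt.
have dt0 : 0 < normc (epow (- a) t * f t - tau.1) - d by rewrite subr_gt0.
have /cvgcP /(_ _ dt0) : cvgc (nbhs t) (fun s => epow (- a) s * f s) (epow (- a) t * f t).
  by apply: cvgcM => //; exact: cvgc_epow_at.
apply: filterS => s h1 h2.
have := normc_triangle (epow (- a) t * f t) (epow (- a) s * f s) tau.1.
by rewrite [in X in _ <= X + _]normc_distC; lra.
Qed.

(* Near [0] the branch stays close to one of finitely many targets, which are
   far apart, hence by connectedness it follows a single one of them. *)
Lemma branch_asymptotics f e0 (ts : seq (R[i] * \bar R)) : 0 < e0 ->
  (forall t, 0 < t < e0 -> cvgc (nbhs t) f (f t)) ->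
  (forall tau, tau \in ts -> target tau) ->
  (forall U, UltraFilter U -> (0 : R)^'+ `<=` U ->
     exists2 tau, tau \in ts & simeq U f tau.1 tau.2) ->
  exists2 tau, tau \in ts & simeq 0^'+ f tau.1 tau.2.
Proof.
move=> e00 fc tts fU.
have sep : \forall d \near (0 : R)^'+, \forall e \near (0 : R)^'+,
    forall tau, tau \in ts -> forall tau', tau' \in ts -> tau != tau' ->
    forall z, near_target d tau e z -> ~ near_target d tau' e z.
  have H tau tau' : tau \in ts -> tau' \in ts ->
      \forall d \near (0 : R)^'+, \forall e \near (0 : R)^'+,
      tau != tau' -> forall z, near_target d tau e z -> ~ near_target d tau' e z.
    move=> h h'; have [->|tt'] := eqVneq tau tau'.
      by apply: nearW => d; apply: nearW.
    have := near_target_separated (tts _ h) (tts _ h') tt'.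
    by apply: filterS => d; apply: filterS => e h0 _.
  have H2 tau : tau \in ts -> \forall d \near (0 : R)^'+, forall tau', tau' \in ts ->
      \forall e \near (0 : R)^'+,
      tau != tau' -> forall z, near_target d tau e z -> ~ near_target d tau' e z.
    by move=> h; apply: near_all => tau' h'; exact: H.
  apply: filterS (near_all H2) => d Hd.
  by apply: near_all => tau h; apply: near_all => tau' h'; exact: Hd.
have [d [d0 {}sep]] := filter_ex (filterI (nbhs_right_gt (0 : R)) sep).
(* [near_ultra] turns the asymptotics along each ultrafilter into a covering by targets near 0. *)
have cover : \forall e \near (0 : R)^'+,
    exists2 tau, tau \in ts & near_target d tau e (f e).
  apply: near_ultra => U UU U0; have [tau h ft] := fU U UU U0.
  by apply: filterS (simeq_near_target d0 ft) => e; exists tau.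
have [e1 [e1_gt0 e10 e1P]] : exists e1 : R, [/\ 0 < e1, e1 <= e0 & forall e, 0 < e < e1 ->
    (forall tau, tau \in ts -> forall tau', tau' \in ts -> tau != tau' ->
     forall z, near_target d tau e z -> ~ near_target d tau' e z) /\
    exists2 tau, tau \in ts & near_target d tau e (f e)].
  have [e1 e1_gt0 e1P] := right_nbhs_interval (filterI sep cover).
  exists (Num.min e1 e0); split; rewrite ?lt_min ?e1_gt0 ?ge_min ?lexx ?orbT//.
  by move=> e /andP[e_gt0]; rewrite lt_min => /andP[ee1 _]; apply: e1P; rewrite e_gt0.
have /choice[h hP] e : exists tau, 0 < e < e1 -> tau \in ts /\ near_target d tau e (f e).
  have [eI|] := boolP (0 < e < e1); last by exists (0, +oo%E).
  by have [_ [tau ? ?]] := e1P e eI; exists tau.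
have huniq e tau : 0 < e < e1 -> tau \in ts -> near_target d tau e (f e) -> tau = h e.
  move=> eI tts' nt; have [he nhe] := hP e eI; apply: contrapT => /eqP th.
  by have [/(_ _ tts' _ he th _ nt)] := e1P e eI.
(* At [t] the branch is near no target other than [h t], and this persists nearby; hence [h] is
   locally constant. *)
have hc t : 0 < t < e1 -> \forall s \near t, h s = h t.
  move=> tI; have /andP[t0 t1] := tI.
  have sI : \forall s \near t, 0 < s < e1 by apply: (near_in_itvoo); rewrite in_itv.
  have ft : cvgc (nbhs t) f (f t) by apply: fc; rewrite t0 (lt_le_trans t1).
  have H : \forall s \near t, forall tau, tau \in ts ->
      tau != h t -> ~ near_target d tau s (f s).
    apply: (@near_all _ (nbhs t) _ _ ts (fun tau s =>
      tau != h t -> ~ near_target d tau s (f s))) => tau ht.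
    have [->|tht] := eqVneq tau (h t); first by apply: nearW.
    have nt : ~ near_target d tau t (f t) by move=> /(huniq _ _ tI ht) /eqP; exact/negP.
    by apply: filterS (near_not_target t0 ft nt) => s hs _.
  apply: filterS2 sI H => s sI Hs; have [hs nhs] := hP s sI.
  by apply: contrapT => /eqP hst; exact: Hs hs hst nhs.
have e12 : 0 < e1 / 2 < e1 by rewrite divr_gt0//= ltr_pdivrMr// ltr_pMr// ltr1n.
pose tau := h (e1 / 2).
have tauts : tau \in ts by have [] := hP _ e12.
exists tau => //.
(* Along each ultrafilter the branch has some leading term in [ts]; it is eventually near this
   target, which by uniqueness is the constant value [tau] of [h]. *)
suff H U : UltraFilter U -> (0 : R)^'+ `<=` U -> simeq U f tau.1 tau.2.
  move: H; case: tau.2 => [a| |] H /=.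
  - by apply: cvgc_ultra => U; exact: H.
  - by apply: near_ultra => U; exact: H.
  - have [U [UU U0]] := @ultraFilterLemma R (0 : R)^'+ _; exact: H UU U0.
move=> UU U0; have [tau' h' ft] := fU U UU U0.
have e1U : \forall e \near U, 0 < e < e1.
  by apply: U0; apply: filterS2 (nbhs_right_gt _) (nbhs_right_lt e1_gt0) => e -> ->.
have [e [eI ne]] := filter_ex (filterI e1U (simeq_near_target d0 ft)).
suff -> : tau = tau' by [].
by rewrite (huniq _ _ eI h' ne); apply: (locally_constant hc).
Qed.

End BranchAsymptotics.

(** * From coefficients to roots *)

Section PolyAt.
Context {R : realType} {n : nat}.
Implicit Types (calP : 'I_n.+1 -> R -> R[i]) (e : R) (s : seq R[i]).

Lemma horner_poly_at calP e x :
  (poly_at calP e).[x] = \sum_j calP j e * x ^+ j.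
Proof.
by rewrite /poly_at horner_sum; apply: eq_bigr => j _; rewrite hornerZ hornerXn.
Qed.

Lemma poly_atE calP e : poly_at calP e = \poly_(j < n.+1) calP (inord j) e.
Proof.
by rewrite poly_def; apply: eq_bigr => j _; rewrite inord_val.
Qed.

Lemma coef_poly_at calP e (j : 'I_n.+1) : (poly_at calP e)`_j = calP j e.
Proof. by rewrite poly_atE coef_poly ltn_ord inord_val. Qed.

Lemma size_poly_at calP e : calP ord_max e = 1 -> size (poly_at calP e) = n.+1.
Proof.
move=> P1; rewrite poly_atE size_poly_eq// (_ : inord n = ord_max) ?P1 ?oner_eq0//.
by apply: val_inj; rewrite /= inordK.
Qed.

Lemma monic_poly_at calP e : calP ord_max e = 1 -> poly_at calP e \is monic.
Proof.
by move=> P1; rewrite monicE /lead_coef size_poly_at//= (coef_poly_at _ _ ord_max) P1.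
Qed.

Lemma roots_with_multP calP e s : calP ord_max e = 1 ->
  roots_with_mult (poly_at calP e) s <-> poly_at calP e = \prod_(x <- s) ('X - x%:P).
Proof.
move=> P1; have mon := monic_poly_at P1; split => [[_ sm]|qE]; last first.
  rewrite /roots_with_mult qE monic_neq0 ?monic_prod_XsubC//.
  by split => // z; rewrite mu_prod_XsubC.
have [r] := closed_field_poly_normal (poly_at calP e).
rewrite (monicP mon) scale1r => qE; rewrite qE; apply: perm_big.
by apply/allP => z _ /=; rewrite sm qE mu_prod_XsubC.
Qed.

Lemma poly_at_split calP e : calP ord_max e = 1 ->
  exists r : 'I_n -> R[i], poly_at calP e = \prod_j ('X - (r j)%:P).
Proof.
move=> P1; have [r] := closed_field_poly_normal (poly_at calP e).
rewrite (monicP (monic_poly_at P1)) scale1r => qE.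
have sr : size r = n.
  by have := size_poly_at P1; rewrite qE size_prod_XsubC => -[].
exists (fun j => r`_j); rewrite qE (big_nth 0) sr big_mkord.
by [].
Qed.

(** Cauchy's bound: outside the unit disc, the norm of [z^n] is at most that of [z^(n-1)] times the
    sum of the norms of the lower coefficients. *)
Lemma root_bound calP e z : calP ord_max e = 1 -> \sum_j calP j e * z ^+ j = 0 ->
  normc z <= 1 + \sum_j normc (calP j e).
Proof.
move=> P1; rewrite big_ord_recr /= P1 mul1r => /eqP; rewrite addrC addr_eq0 => /eqP zn.
have S0 : 0 <= \sum_(j < n) normc (calP (widen_ord (leqnSn n) j) e).
  by apply: sumr_ge0 => j _; exact: normc_ge0.
rewrite big_ord_recr /=.
have [z1|z1] := leP (normc z) 1.
  by apply: le_trans z1 _; rewrite lerDl addr_ge0// normc_ge0.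
have : normc z ^+ n <=
    (\sum_(j < n) normc (calP (widen_ord (leqnSn n) j) e)) * normc z ^+ n.-1.
  rewrite -normcX zn normcN; apply: le_trans (normc_sum _ _ _) _.
  rewrite mulr_suml; apply: ler_sum => j _; rewrite normcM normcX.
  rewrite ler_wpM2l ?normc_ge0// ler_eXn2l//.
  by have := ltn_ord j; lia.
have z0 : 0 < normc z by apply: lt_trans z1.
have [n0|n_gt0] := posnP n.
  rewrite big1 ?mul0r; last by move=> j _; have := ltn_ord j; rewrite {2}n0.
  by rewrite leNgt exprn_gt0.
suff gen (S C : R) : 0 <= S -> 0 <= C -> normc z ^+ n <= S * normc z ^+ n.-1 ->
  normc z <= 1 + (S + C) by apply: gen => //; exact: normc_ge0.
move=> {}S0 C0; rewrite -{1}(prednK n_gt0) exprS ler_pM2r ?exprn_gt0//; lra.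
Qed.

End PolyAt.

Section CoefToRoot.
Context {R : realType} {n : nat} (calP : 'I_n.+1 -> R -> R[i]).
Hypothesis calP_germ : forall j, moderate_germ (calP j).
Hypothesis calP_monic : \forall e \near 0^'+, calP ord_max e = 1.

Lemma germ_interval : exists2 e0 : R, 0 < e0 & forall t, 0 < t < e0 ->
  calP ord_max t = 1 /\ forall j, cvgc (nbhs t) (calP j) (calP j t).
Proof.
have H j : \forall e \near (0 : R)^'+, cvgc (nbhs e) (calP j) (calP j e).
  have [e0 [k [e00 k0 cP _]]] := calP_germ j.
  apply: filterS2 (nbhs_right_gt (0 : R)) (nbhs_right_lt e00) => e eg el; rewrite cvgcE.
  move: cP; rewrite continuous_open_subspace; last exact: interval_open.
  by apply; rewrite inE /= in_itv /= eg.
have [e0 e00 eP] := right_nbhs_interval (filterI calP_monic (filter_forall _ H)).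
by exists e0.
Qed.

Lemma coef_newton_spec p P (c : n.-tuple (\bar R)) : coef_asymptotics calP p P c ->
  nondecr_roots (nth +oo%E c) /\ newton_spec P (nth +oo%E c).
Proof.
move=> [[_ PN Pc] _ [_ P0] _ _]; split; last exact: trop_roots_newton_spec.
by case: Pc => _ cN sc _; exact: nondecr_tuple.
Qed.

(** The nonvanishing conditions cover all vertices: the two ends by [p_n = 1] and the condition on
    [p_0], the others by the strict inequalities between consecutive roots, with [i = n - j]. *)
Lemma vertex_coef p P (c : n.-tuple (\bar R)) (j : 'I_n.+1) :
  coef_asymptotics calP p P c -> vertex n (nth +oo%E c) (n - j)%N ->
  P j != +oo%E -> p`_j != 0.
Proof.
move=> [_ _ [p1 _] p0 pv] + Pj; have jn : (j <= n)%N by rewrite -ltnS.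
have [->|jn'] := eqVneq (j : nat) n; first by rewrite p1 oner_eq0.
have [j0|j0] := eqVneq (j : nat) 0%N.
  move=> _; case: p0 => [|P0]; first by rewrite j0.
  by move: Pj; rewrite (_ : j = ord0) ?P0//; exact: val_inj.
rewrite /vertex => /or3P[h|h|h]; [exfalso; lia|exfalso; lia|].
have -> : (j : nat) = (n - (n - j))%N by lia.
by apply: pv => //; lia.
Qed.

Lemma coef_edge_poly (p : {poly R[i]}) (P : 'I_n.+1 -> \bar R) (a : R) (j : 'I_n.+1) :
  (edge_poly p P a)`_j =
  if trop_eval P a%:E == (P j + a%:E *+ j)%E then p`_j else 0.
Proof.
rewrite /edge_poly coef_sum big_mkcond (bigD1 j)//= big1 ?addr0.
  by case: ifP => // _; rewrite coefZ coefXn eqxx mulr1.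
move=> k kj; case: ifP => // _; rewrite coefZ coefXn.
by rewrite (_ : (j == k :> nat) = false) ?mulr0// eq_sym; exact/negbTE.
Qed.

(** The tropical value at [a] is attained at a vertex, whose coefficient is nonzero and occurs in
    the edge polynomial. *)
Lemma edge_poly_neq0 p P (c : n.-tuple (\bar R)) (a : R) :
  coef_asymptotics calP p P c -> edge_poly p P a != 0.
Proof.
move=> H; have [ng Pg] := coef_newton_spec H.
have [k kn [vk mk]] := min_sum_vertex n a%:E ng.
pose m : 'I_n.+1 := Ordinal (leq_subr k n : (n - k < n.+1)%N).
have nm : (n - m)%N = k by rewrite subKn.
have Pm : P m = psum (nth +oo%E c) k by case: Pg => _ _ ->; rewrite nm.
have Pma : trop_eval P a%:E = (P m + a%:E *+ m)%E.
  by rewrite (newton_spec_eval _ ng Pg) Pm.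
have pm0 : p`_m != 0.
  apply: (vertex_coef H); first by rewrite nm.
  apply/eqP => Poo; have := min_sum_fin n a ng.
  by rewrite -(newton_spec_eval _ ng Pg) Pma Poo fin_enatmul.
apply: contra_neq pm0 => e0; have := coef_edge_poly p P a m.
by rewrite -Pma eqxx e0 coef0.
Qed.

Lemma first_order_moderate (f : R -> R[i]) (y : R[i]) (A : \bar R) (e0 : R) : 0 < e0 ->
  (forall t, 0 < t < e0 -> cvgc (nbhs t) f (f t)) -> simeq 0^'+ f y A ->
  moderate_germ f.
Proof.
move=> e00 fc fA.
have [k k0 fk] : exists2 k : R, 0 < k & \forall e \near 0^'+, normc (f e) <= e `^ (- k).
  case: A fA => [r| |]//= fr; last first.
    exists 1 => //; apply: filterS fr => e ->; rewrite normc0; exact: powR_ge0.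
  have fb : \forall e \near 0^'+, normc (f e) <= (normc y + 1) * e `^ r.
    exact: simeq_bounded fr.
  have C0 : 0 < normc y + 1 by rewrite ltr_wpDl ?normc_ge0.
  have k0 : 0 < `|r| + 1 by rewrite ltr_wpDl.
  (* The part [|r|] absorbs the power [e^r], and the additional 1 absorbs the constant, since
     [normc y + 1 <= e^-1] for small [e]. *)
  exists (`|r| + 1) => //.
  have e1 := nbhs_right_lt (divr_gt0 ltr01 C0).
  apply: filterS2 (filterI near01 fb) e1 => e [/andP[eg el] fe].
  rewrite ltr_pdivlMr// => eC; apply: le_trans fe _.
  have -> : e `^ (- (`|r| + 1)) = e `^ (- 1 - (r + `|r|)) * e `^ r.
    rewrite -powRD; last by apply/implyP => _; rewrite gt_eqF.
    by congr (_ `^ _); ring.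
  rewrite ler_wpM2r ?powR_ge0//.
  apply: (@le_trans _ _ (e `^ (- 1))); last first.
    apply: ger_powR; first by rewrite eg ltW.
    by have := ler_norm (- r); rewrite normrN; lra.
  by rewrite powR_inv1 ?(ltW eg)// -[e^-1]mul1r ler_pdivlMr// mulrC ltW.
have [e1 e10 fe1] := right_nbhs_interval fk.
exists (Num.min e0 e1), k; split => //.
- by rewrite lt_min e00.
- rewrite continuous_open_subspace; last exact: interval_open.
  move=> t; rewrite inE /= in_itv /= lt_min => /and3P[t0 te0 _].
  by have := fc t; rewrite cvgcE; apply; rewrite t0.
- by move=> t; rewrite in_itv /= lt_min => /and3P[t0 _ te1]; apply: fe1; rewrite t0.
Qed.

Theorem coef_to_root p P (c : n.-tuple (\bar R)) : coef_asymptotics calP p P c ->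
  exists calY y Y, root_asymptotics calP calY y Y.
Proof.
move=> H; have [ng Pg] := coef_newton_spec H.
have [e0 e00 e0P] := germ_interval.
have cP : forall j : 'I_n.+1, simeq 0^'+ (calP j) p`_j (P j).
  by case: H => _ cP _ _ _ j; rewrite -simeq_powE.
have /choice[f fP] t : exists r : 'I_n -> R[i],
    0 < t < e0 -> poly_at calP t = \prod_j ('X - (r j)%:P).
  have [tI|] := boolP (0 < t < e0); last by exists (fun=> 0).
  by have [r rE] := poly_at_split (e0P t tI).1; exists r.
have fE t : 0 < t < e0 -> forall x, \prod_j (x - f t j) = \sum_j calP j t * x ^+ j.
  by move=> tI x; rewrite -horner_poly_at fP// horner_prod_XsubC.
have near_I t : 0 < t < e0 -> \forall s \near t, 0 < s < e0.
  by move=> tI; apply: near_in_itvoo; rewrite in_itv.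
have fc t : 0 < t < e0 -> forall x,
    cvgc (nbhs t) (fun s => \prod_j (x - f s j)) (\prod_j (x - f t j)).
  move=> tI x; rewrite fE//.
  apply: (@cvgc_near_eq _ _ _ _ (fun s => \sum_j calP j s * x ^+ j)).
    by apply: filterS (near_I t tI) => s sI; rewrite fE.
  apply: cvgc_sum => j _; apply: cvgcM; last exact: cvgc_cst.
  exact: (e0P t tI).2.
have fb t : 0 < t < e0 -> exists M : R, \forall s \near t, forall j, normc (f s j) <= M.
  move=> tI; exists (1 + \sum_j (normc (calP j t) + 1)).
  have cb : \forall s \near t, forall j, normc (calP j s) <= normc (calP j t) + 1.
    exact: (filter_forall _ (fun j => cvgc_bounded ((e0P t tI).2 j))).
  apply: filterS2 (near_I t tI) cb => s sI sb j.
  apply: (@le_trans _ _ (1 + \sum_j normc (calP j s))).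
    apply: root_bound; first exact: (e0P s sI).1.
    by rewrite -fE// (bigD1 j)//= subrr mul0r.
  by rewrite lerD2l; apply: ler_sum => k _; exact: sb.
have [Z [Zc Zf]] := continuous_roots fc fb.
have Zroot t : 0 < t < e0 -> poly_at calP t = \prod_j ('X - (Z j t)%:P).
  move=> tI; rewrite fP//; have [s sE] := Zf t tI.
  by rewrite (reindex_inj (@perm_inj _ s)) /=; apply: eq_bigr => j _; rewrite sE.
pose edge_roots (a : R) : seq R[i] :=
  sval (closed_field_poly_normal (edge_poly p P a)).
(* All candidate leading terms: zero, and the nonzero roots of the edge polynomials. An infinite
   entry of [c] contributes the scale [fine +oo = 0], and its pairs are still targets. *)
pose ts : seq (R[i] * \bar R) := (0, +oo%E) ::
  [seq ((w : R[i]), (a%:E)%E) | a <- [seq fine x | x <- c],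
                                w <- [seq w <- edge_roots a | w != 0]].
have tts tau : tau \in ts -> target tau.
  rewrite inE => /predU1P[->|]; first by right.
  move=> /allpairsPdep[a [w [_]]]; rewrite mem_filter => /andP[w0 _] ->.
  by left.
have edge0 a : edge_poly p P a != 0 := edge_poly_neq0 a H.
have conv j : exists2 tau, tau \in ts & simeq 0^'+ (Z j) tau.1 tau.2.
  apply: (branch_asymptotics e00 (Zc j) tts) => U UU U0.
  have cPU (k : 'I_n.+1) : simeq U (calP k) p`_k (P k).
    have := cP k; case: (P k) => [s| |]//=; last exact: U0.
    exact: cvgc_sub_filter.
  have Zr : \forall e \near U, \sum_k calP k e * Z j e ^+ k = 0.
    apply: U0; apply: filterS2 (nbhs_right_gt (0 : R)) (nbhs_right_lt e00) => e eg el.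
    rewrite -horner_poly_at Zroot ?eg// horner_prod_XsubC (bigD1 j)//= subrr mul0r.
    by [].
  have [Z0|[a [[i iN ga] [w [w0 Zw rw]]]]] :=
    root_scale U0 ng Pg cPU (fun k => vertex_coef H) Zr.
    by exists (0, +oo%E); rewrite ?mem_head.
  exists (w, a%:E); last exact: Zw.
  rewrite inE; apply/orP; right; apply/allpairsPdep; exists a, w; split => //.
    by apply/mapP; exists (a%:E)%E => //; rewrite -ga mem_nth// size_tuple.
  rewrite mem_filter w0 /edge_roots; case: closed_field_poly_normal => r rE /=.
  move: rw; rewrite {1}rE rootZ ?lead_coef_eq0// root_prod_XsubC.
  by [].
have {conv} /choice[tau tauP] j : exists tau, target tau /\ simeq 0^'+ (Z j) tau.1 tau.2.
  by have [tau th tz] := conv j; exists tau; split => //; exact: tts.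
pose ordr i j := ((tau i).2 <= (tau j).2)%E.
pose si := sort ordr (enum 'I_n).
have ssi : size si == n by rewrite size_sort size_enum_ord.
pose idx := Tuple ssi.
exists (fun j => Z (tnth idx j)), [tuple (tau (tnth idx j)).1 | j < n],
  [tuple (tau (tnth idx j)).2 | j < n].
split.
- by move=> j; have [_ /(first_order_moderate e00 (Zc _))] := tauP (tnth idx j).
- apply: filterS2 (nbhs_right_gt (0 : R)) (nbhs_right_lt e00) => e eg el.
  have eI : 0 < e < e0 by rewrite eg.
  apply/roots_with_multP; first exact: (e0P e eI).1.
  rewrite Zroot// big_image /=.
  rewrite -(big_tuple _ _ idx xpredT (fun j => 'X - (Z j e)%:P)) /=.
  transitivity (\prod_(j <- enum 'I_n) ('X - (Z j e)%:P)); first by rewrite big_enum.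
  by apply: perm_big; rewrite perm_sym perm_sort.
- move=> j; rewrite !tnth_mktuple /first_order simeq_powE.
  have [tj sj] := tauP (tnth idx j); split => //.
  by case: tj => [|[->]]; [left|right].
- have : sorted ordr si.
    apply: sort_sorted => i j; exact: le_total.
  have -> : tval [tuple (tau (tnth idx j)).2 | j < n] = [seq (tau j).2 | j <- si].
    have siE : [seq tnth idx j | j <- enum 'I_n] = si by rewrite map_tnth_enum.
    by rewrite -siE -map_comp.
  by rewrite sorted_map.
Qed.

End CoefToRoot.

(** * From roots to coefficients *)

Lemma coef_prod_XsubC_ord (K : comNzRingType) (n : nat) (f : 'I_n -> K) (m : nat) :
  (m <= n)%N -> (\prod_j ('X - (f j)%:P))`_m =
  (-1) ^+ (n - m)%N * \sum_(I : {set 'I_n} | #|I| == (n - m)%N) \prod_(i in I) f i.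
Proof.
move=> mn.
have gen (ps : seq K) N : size ps = N -> (m <= N)%N ->
    (\prod_(x <- ps) ('X - x%:P))`_m =
    (-1) ^+ (N - m)%N * \sum_(I : {set 'I_N} | #|I| == (N - m)%N) \prod_(i in I) ps`_i.
  by move=> <-; exact: coef_prod_XsubC.
have -> : \prod_j ('X - (f j)%:P) = \prod_(x <- [tuple f j | j < n]) ('X - x%:P).
  by rewrite big_tuple; apply: eq_bigr => j _; rewrite tnth_mktuple.
rewrite (gen _ n (size_tuple _) mn); congr (_ * _).
apply: eq_bigr => I _; apply: eq_bigr => i _.
by rewrite -tnth_nth tnth_mktuple.
Qed.

Lemma card_set_ord_gt (n k : nat) (I : {set 'I_n}) : (k < #|I|)%N ->
  exists2 i, i \in I & (k <= i)%N.
Proof.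
move=> kI; apply/exists_inP; rewrite -[X in is_true X]negbK negb_exists_in.
apply/negP => /forall_inP H.
have : (size [seq val i | i <- enum I] <= size (iota 0 k))%N.
  apply: uniq_leq_size; first by rewrite map_inj_uniq ?enum_uniq//; exact: val_inj.
  move=> _ /mapP[i + ->]; rewrite mem_enum => /H.
  by rewrite -ltnNge mem_iota add0n.
by rewrite size_map size_iota -cardE leqNgt kI.
Qed.

(** Among [k.+1] distinct indices one is at least [k], so its term is at least [g k]; remove it and
    induct. *)
Lemma psum_le_set (R : realType) (n : nat) (g : nat -> \bar R) (I : {set 'I_n}) :
  nondecr_roots g -> (psum g #|I| <= \sum_(i in I) g i)%E.
Proof.
move=> [gm gN]; move: {2}#|I| (erefl #|I|) => k; elim: k I => [|k IH] I Ik.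
  by rewrite Ik /psum big_geq// (cards0_eq Ik) big_set0.
have [|i iI ki] := @card_set_ord_gt n k I; first by rewrite Ik.
rewrite (bigD1 i)//= Ik psumS addeC leeD ?gm//.
have IiE : #|I :\ i| = k.
  by move: Ik; rewrite (cardsD1 i) iI => -[].
have := IH _ IiE; rewrite IiE => /le_trans; apply.
by rewrite le_eqVlt; apply/orP; left; apply/eqP; apply: eq_bigl => j; rewrite !inE andbC.
Qed.

Section RootToCoef.
Context {R : realType} {n : nat} (calP : 'I_n.+1 -> R -> R[i]).
Hypothesis calP_monic : \forall e \near 0^'+, calP ord_max e = 1.
Variables (calY : 'I_n -> R -> R[i]) (y : n.-tuple R[i]) (Y : n.-tuple (\bar R)).
Hypothesis rootY : root_asymptotics calP calY y Y.

Let g := nth +oo%E Y.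

Lemma root_simeq j : simeq 0^'+ (calY j) (tnth y j) (tnth Y j).
Proof. by case: rootY => _ _ /(_ j) [+ _] _; rewrite simeq_powE. Qed.

Lemma root_nondecr : nondecr_roots g.
Proof.
apply: nondecr_tuple; first by case: rootY.
by move=> j; exact: simeq_neqNy (root_simeq j).
Qed.

Lemma root_neq0 j : tnth Y j != +oo%E -> tnth y j != 0.
Proof. by case: rootY => _ _ /(_ j) [_ [[]//|->]] _; rewrite eqxx. Qed.

Lemma near_prod_roots : \forall e \near 0^'+,
  poly_at calP e = \prod_j ('X - (calY j e)%:P).
Proof.
case: rootY => _ rY _ _; apply: filterS2 calP_monic rY => e P1.
by move/(roots_with_multP _ P1) ->; rewrite big_image.
Qed.

Definition root_exponents (j : 'I_n.+1) : \bar R := psum g (n - j)%N.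

(** Leading part of Vieta's formula: among the products of [n - j] roots, only those of minimal
    total exponent contribute. *)
Definition root_coefs : {poly R[i]} := \poly_(j < n.+1)
  ((-1) ^+ (n - j)%N * \sum_(I : {set 'I_n} | #|I| == (n - j)%N)
     if psum g (n - j)%N == (\sum_(i in I) tnth Y i)%E
     then \prod_(i in I) tnth y i else 0).

Lemma root_coefs_simeq (j : 'I_n.+1) :
  simeq 0^'+ (calP j) root_coefs`_j (root_exponents j).
Proof.
have jn : (j <= n)%N by rewrite -ltnS.
rewrite /root_coefs coef_poly ltn_ord.
apply: (@simeq_near_eq _ _ _ (fun e => (-1) ^+ (n - j)%N *
   \sum_(I : {set 'I_n} | #|I| == (n - j)%N) \prod_(i in I) calY i e)).
  apply: filterS near_prod_roots => e Pe.
  by rewrite -(coef_poly_at calP) Pe coef_prod_XsubC_ord.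
rewrite -[root_exponents j]add0e; apply: simeqM => //; first exact: simeq_cst.
have BN : root_exponents j != -oo%E by exact: psum_nNy root_nondecr.
apply: simeq_sum => // I /eqP Ij; apply: simeq_le => //.
- rewrite /root_exponents -Ij; apply: le_trans (psum_le_set _ root_nondecr) _.
  by apply: lee_sum => i _; rewrite /g (tnth_nth +oo%E).
- by apply: simeq_prod => // i _; exact: root_simeq.
Qed.

Lemma root_newton_spec : newton_spec root_exponents g.
Proof. by split => //; rewrite /root_exponents /= subnn /psum big_geq. Qed.

(** When [a] lies strictly between the roots, no factor has exponent [a], so the edge polynomial is
    the monomial in ['X^(n - k)] whose coefficient is the product of the [- y_j] for [j < k]. *)
Lemma root_coefs_vertex (k : nat) (a : R) : (k <= n)%N ->
  (forall i, (i < k)%N -> (g i < a%:E)%E) ->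
  (forall i, (k <= i < n)%N -> (a%:E < g i)%E) -> root_coefs`_(n - k) != 0.
Proof.
move=> kn ga ag.
pose m : 'I_n.+1 := Ordinal (leq_subr k n : (n - k < n.+1)%N).
have nm : (n - m)%N = k by rewrite subKn.
have Te : trop_eval root_exponents a%:E = min_sum n g a%:E.
  exact: newton_spec_eval root_nondecr root_newton_spec.
have mE : min_sum n g a%:E = (psum g k + a%:E *+ (n - k))%E.
  by apply: min_sumE => // i ik; apply: ltW; [exact: ga|exact: ag].
have := coef_edge_poly root_coefs root_exponents a m.
rewrite Te mE /root_exponents nm eqxx => <-.
rewrite (edge_poly_prod (@subset_refl _ _) root_coefs_simeq root_simeq); last 2 first.
- by rewrite Te -min_sum_tuple.
- apply: filterS near_prod_roots => e Pe x.
  by rewrite -horner_poly_at Pe horner_prod_XsubC.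
have -> : \prod_j edge_factor a (tnth y j) (tnth Y j) =
    \prod_(0 <= j < n) edge_factor a y`_j (g j).
  by rewrite big_mkord; apply: eq_bigr => j _; rewrite (tnth_nth 0) (tnth_nth +oo%E Y).
rewrite (@big_cat_nat _ _ _ k)//=.
have -> : \prod_(k <= j < n) edge_factor a y`_j (g j) = 'X^(n - k)%N.
  rewrite -prodr_const_nat; apply: eq_big_nat => j jk.
  by rewrite /edge_factor ltNge (ltW (ag j jk)) /= gt_eqF// ag.
have -> : \prod_(0 <= j < k) edge_factor a y`_j (g j) = (\prod_(0 <= j < k) - y`_j)%:P.
  rewrite rmorph_prod; apply: eq_big_nat => j /andP[_ jk].
  by rewrite /edge_factor ga.
rewrite coefCM coefXn eqxx mulr1 big_nat.
rewrite prodf_seq_neq0; apply/allP => j; rewrite mem_index_iota => /andP[_ jk].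
apply/implyP => _; rewrite oppr_eq0.
have jn : (j < n)%N by exact: leq_trans jk kn.
have := @root_neq0 (Ordinal jn); rewrite (tnth_nth 0 y) (tnth_nth +oo%E Y) /=; apply.
by rewrite lt_eqF// (lt_trans (ga j jk))// ltry.
Qed.

Theorem root_to_coef : coef_asymptotics calP root_coefs root_exponents Y.
Proof.
have ng := root_nondecr.
split.
- split; first exact: size_poly.
    by move=> j; exact: psum_nNy ng.
  apply: newton_spec_trop_roots; [by case: rootY| |exact: root_newton_spec].
  by move=> j; exact: simeq_neqNy (root_simeq j).
- by move=> j; rewrite simeq_powE; exact: root_coefs_simeq.
- have P0 : root_exponents ord_max = 0%E by case: root_newton_spec.
  split => //; have := root_coefs_simeq ord_max; rewrite P0 => h.
  have h1 : simeq 0^'+ (calP ord_max) 1 0%E.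
    apply: (@simeq_near_eq _ _ _ (fun=> 1)); last exact: simeq_cst.
    by apply: filterS calP_monic => e ->.
  exact: (simeq_unique h h1).
- have [P0|P0] := eqVneq (root_exponents ord0) +oo%E; [by right|left].
  have gfin i : (i < n)%N -> g i != +oo%E.
    move=> iN; apply/eqP => gi; move: P0.
    by rewrite /root_exponents /= subn0 (psum_eqy ng iN gi) eqxx.
  rewrite -(subnn n); apply: (@root_coefs_vertex n (fine (g n.-1) + 1)) => // i iN;
    last by lia.
  apply: (@le_lt_trans _ _ (g n.-1)); first by case: ng => gm _; apply: gm; lia.
  have n1 : (n.-1 < n)%N by lia.
  rewrite -[ltLHS]fineK; first by rewrite lte_fin ltrDl.
  by rewrite fin_numE gfin// andbT; case: ng.
- move=> i /andP[i0 iN] gi.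
  have gfin : g i.-1 \is a fin_num.
    by rewrite fin_numE; case: ng => _ -> /=; rewrite lt_eqF// (lt_le_trans gi)// leey.
  (* Any real strictly between the two roots isolates the vertex; [g i] may be infinite. *)
  have [a [ga ag]] : exists a : R, (g i.-1 < a%:E)%E /\ (a%:E < g i)%E.
    move: gi; rewrite -/g -(fineK gfin); case: (g i) => [b| |]// ab.
      by exists ((fine (g i.-1) + b) / 2); rewrite !lte_fin in ab *; split; lra.
    by exists (fine (g i.-1) + 1); rewrite lte_fin ltrDl ltry.
  apply: (@root_coefs_vertex i a); first by lia.
  + move=> l li; apply: le_lt_trans ga; case: ng => gm _; apply: gm; lia.
  + move=> l /andP[li _]; apply: lt_le_trans ag _; case: ng => gm _; exact: gm.
Qed.

End RootToCoef.

(** * Consequences for the exponents and the edge polynomials *)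

Section Consequences.
Context {R : realType} {n : nat} (calP : 'I_n.+1 -> R -> R[i]).
Variables (p : {poly R[i]}) (P : 'I_n.+1 -> \bar R) (c : n.-tuple (\bar R)).
Hypothesis coefP : coef_asymptotics calP p P c.

Lemma coef_simeq (j : 'I_n.+1) : simeq 0^'+ (calP j) p`_j (P j).
Proof. by case: coefP => _ /(_ j) + _ _ _; rewrite simeq_powE. Qed.

Lemma exponent_poly_ge (j : 'I_n.+1) : (P j <= exponent_poly calP j)%E.
Proof. exact: simeq_exponent_ge (coef_simeq j). Qed.

(** At a vertex the leading coefficient is nonzero or the germ is zero, so the exponent is exactly
    [P j]; elsewhere it is at least [P j]. *)
Lemma exponent_newton_spec : newton_spec (exponent_poly calP) (nth +oo%E c).
Proof.
have [ng [P0 Pge Pv]] := coef_newton_spec coefP.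
have Ev (j : 'I_n.+1) : vertex n (nth +oo%E c) (n - j)%N -> exponent_poly calP j = P j.
  move=> vj; apply: simeq_exponent (coef_simeq j) _.
  by have [->|Pj] := eqVneq (P j) +oo%E; [right|left; exact: vertex_coef coefP vj Pj].
split=> [|j|j vj].
- by rewrite Ev ?P0// /= subnn.
- exact: le_trans (Pge j) (exponent_poly_ge j).
- by rewrite Ev// Pv.
Qed.

End Consequences.

Lemma edge_factor_root (R : realType) (a : R) (y : R[i]) (Y : \bar R) (z : R[i]) :
  Y != a%:E -> (Y != +oo%E -> y != 0) -> z != 0 -> ~~ root (edge_factor a y Y) z.
Proof.
move=> Ya y0 z0; rewrite /edge_factor (negbTE Ya); case: ifP => Ylt; last by rewrite rootX.
rewrite rootC oppr_eq0; apply: y0.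
by rewrite lt_eqF// (lt_trans Ylt)// ltry.
Qed.

(** Factors of exponent other than [a] have no nonzero root, so the nonzero roots come from the [m]
    consecutive factors ['X - y_j]. *)
Lemma nonzero_roots_edge_prod (R : realType) (n : nat) (y : n.-tuple R[i])
    (c : n.-tuple (\bar R)) (a : R) (i m : nat) :
  (forall j, tnth c j != +oo%E -> tnth y j != 0) ->
  count_mem a%:E c = m -> (i + m <= n)%N ->
  (forall k, (i <= k < i + m)%N -> nth +oo%E c k = a%:E) ->
  forall z, count_mem z (take m (drop i y)) =
    if z == 0 then 0%N else mup z (\prod_j edge_factor a (tnth y j) (tnth c j)).
Proof.
move=> y0 cm imn ca z; set s := take m (drop i y).
have sz_s : size s = m by rewrite size_take size_drop size_tuple; case: ltnP => //; lia.
have s_nth k : (k < m)%N -> nth 0 s k = nth 0 y (i + k).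
  by move=> km; rewrite nth_take// nth_drop.
have ynth k : (k < n)%N -> nth +oo%E c k != +oo%E -> nth 0 y k != 0.
  move=> kn; have := y0 (Ordinal kn).
  by rewrite (tnth_nth 0 y) (tnth_nth +oo%E c).
have [->|z0] := eqVneq z 0.
  apply/count_memPn/negP => /(nthP 0)[k]; rewrite sz_s => km; rewrite s_nth// => yk.
  have ik : (i + k < n)%N by lia.
  by have := ynth _ ik; rewrite yk eqxx ca ?leq_addr ?ltn_add2l// => /(_ isT).
(* An index outside the block with root [a] would make [m.+1] occurrences of [a] in [c]. *)
have outside k : (k < n)%N -> ~~ (i <= k < i + m)%N -> nth +oo%E c k != a%:E.
  move=> kn kim; apply/negP => ck.
  have : (size (k :: iota i m) <= size [seq l <- iota 0 n | nth +oo%E c l == a%:E])%N.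
    apply: uniq_leq_size; first by rewrite /= mem_iota kim iota_uniq.
    move=> l; rewrite inE mem_filter !mem_iota => /predU1P[->|lim]; first by rewrite ck.
    by rewrite ca// eqxx /=; lia.
  have -> : size [seq l <- iota 0 n | nth +oo%E c l == a%:E] = m.
    by rewrite size_filter -cm -[in RHS](mkseq_nth +oo%E c) size_tuple count_map.
  by rewrite /= size_iota ltnn.
have -> : \prod_j edge_factor a (tnth y j) (tnth c j) =
    \prod_(0 <= j < n) edge_factor a (nth 0 y j) (nth +oo%E c j).
  by rewrite big_mkord; apply: eq_bigr => j _; rewrite (tnth_nth 0 y) (tnth_nth +oo%E c).
rewrite (@big_cat_nat _ _ _ i)//=; last by lia.
rewrite (@big_cat_nat _ _ _ (i + m) i)//=; last by lia.
have nroot l u : (u <= n)%N -> (forall j, (l <= j < u)%N -> ~~ (i <= j < i + m)%N) ->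
    ~~ root (\prod_(l <= j < u) edge_factor a (nth 0 y j) (nth +oo%E c j)) z.
  move=> un lu; rewrite rootE horner_prod prodf_seq_neq0; apply/allP => j.
  rewrite mem_index_iota => jlu /=; apply: edge_factor_root => //.
    by apply: outside; [lia|exact: lu].
  by apply: ynth; lia.
rewrite mupMr; last by apply: nroot => [|j]; lia.
rewrite mupMl; last by apply: nroot => [|j]; lia.
have -> : \prod_(i <= j < i + m) edge_factor a (nth 0 y j) (nth +oo%E c j) =
    \prod_(x <- s) ('X - x%:P).
  rewrite [RHS](big_nth 0) sz_s -{1}(add0n i) big_addn addKn.
  apply: eq_big_nat => j /andP[_ jm]; rewrite ca; last by lia.
  by rewrite /edge_factor ltxx eqxx s_nth// addnC.
by rewrite mu_prod_XsubC.
Qed.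

Local Close Scope complex_scope.

Theorem theorem6p2 (R : realType) (n : nat) (calP : 'I_n.+1 -> R -> R[i])
  (hC : forall j, moderate_germ (calP j))
  (hmonic : \forall e \near 0^'+, calP ord_max e = 1) :
  ((exists calY y Y, root_asymptotics calP calY y Y) <->
   (exists p P c, coef_asymptotics calP p P c)) /\
  (forall calY y Y p P c,
    root_asymptotics calP calY y Y -> coef_asymptotics calP p P c ->
    [/\ forall j, (P j <= exponent_poly calP j)%E,
        forall k : nat, trop_hull (exponent_poly calP) k = trop_hull P k,
        trop_roots (exponent_poly calP) c /\ c = Y &
        forall (c0 : R) (i m : nat),
          (0 < m)%N -> count_mem c0%:E c = m -> (i + m <= n)%N ->
          (forall k : nat, (i <= k < i + m)%N -> nth +oo%E c k = c0%:E) ->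
          nonzero_roots_with_mult (edge_poly p P c0) (take m (drop i y))]).
Proof.
split; first split.
- move=> [calY [y [Y rootY]]].
  by exists (root_coefs y Y), (root_exponents Y), Y; exact (root_to_coef hmonic rootY).
- by move=> [p [P [c coefP]]]; exact (coef_to_root hC hmonic coefP).
move=> calY y Y p P c rootY coefP.
have [ng Pg] := coef_newton_spec coefP.
have Ec := exponent_newton_spec coefP.
(* Both [c] and [Y] describe the Newton polygon of the exponents; for [Y], through the coefficient
   data built from the roots. *)
have cY : c = Y.
  apply: newton_spec_unique ng (root_nondecr rootY) Ec _.
  exact: exponent_newton_spec (root_to_coef hmonic rootY).
split.
- exact: exponent_poly_ge coefP.
- exact: newton_spec_trop_hull ng Ec Pg.
- split => //; case: coefP => -[_ _ [_ cN sc _]] _ _ _ _.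
  exact: newton_spec_trop_roots sc cN Ec.
- move=> c0 i m _ cm imn ck; split; first exact: edge_poly_neq0 coefP.
  rewrite (edge_poly_prod (@subset_refl _ _) (coef_simeq coefP)
    (root_simeq rootY)); last 2 first.
  + by rewrite -cY (newton_spec_eval _ ng Pg) min_sum_tuple.
  + apply: filterS (near_prod_roots hmonic rootY) => e Pe x.
    by rewrite -horner_poly_at Pe horner_prod_XsubC.
  rewrite -cY; apply: nonzero_roots_edge_prod => // j.
  by rewrite cY; exact: (root_neq0 rootY).
Qed.
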